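(* Let $d\in\mathbb{N}$, let $D$ be a non-empty subset of $\mathbb{Z}/d\mathbb{Z}$, and let $\alpha\in B_n$. Then $$\mathrm{tr}_{d,D}(q,z)(\alpha^* )=\mathrm{tr}_{d,D}\bigl(q^{-1},\,z-(q-q^{-1})E_D\bigr)(\alpha),$$ or equivalently, in the variables $(q,\lambda_D)$, $$\mathrm{tr}_{d,D}(q,\lambda_D)(\alpha^* )=\mathrm{tr}_{d,D}\bigl(q^{-1},\lambda_D^{-1}\bigr)(\alpha).$$
   Context: Framed braid group: $\mathcal{F}_n\cong\mathbb{Z}^n\rtimes B_n$ is generated by the braid generators $\sigma_1,\dots,\sigma_{n-1}$ of $B_n$ and framing generators $t_1,\dots,t_n$, with the braid relations, $t_it_j=t_jt_i$ and $t_j\sigma_i=\sigma_it_{s_i(j)}$, $s_i=(i,i+1)$. $\mathcal{F}_{d,n}$ is the quotient by $t_j^d=1$ for all $j$; put $e_i:=\frac1d\sum_{s=1}^{d}t_i^st_{i+1}^{-s}\in\mathbb{C}\mathcal{F}_{d,n}$. Yokonuma--Hecke algebra: for $q\in\mathbb{C}\setminus\{0\}$, $\mathrm{Y}_{d,n}(q)$ is the quotient of $\mathbb{C}\mathcal{F}_{d,n}$ by the ideal generated by $\sigma_i^2-1-(q-q^{-1})e_i\sigma_i$; $g_i$ is the image of $\sigma_i$. There are natural inclusions $\mathrm{Y}_{d,n}(q)\subset\mathrm{Y}_{d,n+1}(q)$. Trace: for indeterminates $z,x_1,\dots,x_{d-1}$, $\mathrm{tr}_d:\bigcup_{n\ge0}\mathrm{Y}_{d,n}(q)\to\mathbb{C}[z,x_1,\dots,x_{d-1}]$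 is the unique linear map (Juyumaya) with $\mathrm{tr}_d(ab)=\mathrm{tr}_d(ba)$, $\mathrm{tr}_d(1)=1$, $\mathrm{tr}_d(ag_n)=z\,\mathrm{tr}_d(a)$, $\mathrm{tr}_d(at_{n+1}^s)=x_s\,\mathrm{tr}_d(a)$ ($1\le s\le d-1$) for all $n$ and $a,b\in\mathrm{Y}_{d,n}(q)$. Specialized trace: the E-system is the system $E^{(m)}=x_mE$ ($1\le m\le d-1$) over $\mathbb{C}$, where $E^{(m)}=\frac1d\sum_{s=0}^{d-1}x_{m+s}x_{d-s}$, $E=E^{(0)}$, indices mod $d$, $x_0=1$. Its solutions are parametrized (Gérardin) by the non-empty subsets $D\subseteq\mathbb{Z}/d\mathbb{Z}$: the solution $X_D=(\mathrm{x}_1,\dots,\mathrm{x}_{d-1})$ is $\mathrm{x}_k=\frac1{|D|}\sum_{m\in D}\exp(2\pi km\sqrt{-1}/d)$. $\mathrm{tr}_{d,D}:\bigcup_n\mathrm{Y}_{d,n}(q)\to\mathbb{C}[z]$ is $\mathrm{tr}_d$ with $(x_1,\dots,x_{d-1})$ specialized to $X_D$, and $E_D:=\mathrm{tr}_{d,D}(e_i)=1/|D|$. Notation: for a braid $\alpha\in B_n$, $\mathrm{tr}_{d,D}(q,z)(\alpha)$ is $\mathrm{tr}_{d,D}$ of the image of $\alpha$ in $\mathrm{Y}_{d,n}(q)$ under $\sigma_i\mapsto g_i$, regarded as a polynomial expression in $q^{\pm1}$ and $z$, in which other values can be substituted for $q$ and $z$. Put $\lambda_D:=\frac{z-(q-q^{-1})E_D}{z}$,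 equivalently $z=\frac{(q-q^{-1})E_D}{1-\lambda_D}$; $\mathrm{tr}_{d,D}(q,\lambda_D)(\alpha)$ is the same quantity expressed in the variables $(q,\lambda_D)$ through this change of variables. Mirror image: $\alpha\mapsto\alpha^*$ is the group automorphism of $B_n$ given by $\sigma_i\mapsto\sigma_i^{-1}$. *)

(* Defs.v *)
From HB Require Import structures.
From mathcomp Require Import all_boot all_order all_algebra.
From mathcomp Require Import boolp reals perm.
From mathcomp Require Import complex.
From mathcomp Require Import finmap monalg.
From mathcomp Require trigo.

Set Implicit Arguments.
Unset Strict Implicit.
Unset Printing Implicit Defensive.

Import GRing.Theory Num.Theory.

Local Open Scope ring_scope.
Local Open Scope quotient_scope.

(* The letter (x, true) stands for the generator x, and (x, false) for its
   inverse. *)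
Definition word (X : Type) := seq (X * bool).

Inductive wcong (X : Type) (r : word X -> word X -> Prop) :
    word X -> word X -> Prop :=
| WRel u v : r u v -> wcong r u v
| WInv x b : wcong r [:: (x, b); (x, ~~ b)] [::]
| WRefl u : wcong r u u
| WSym u v : wcong r u v -> wcong r v u
| WTrans u v w : wcong r u v -> wcong r v w -> wcong r u w
| WCat u u' v v' :
    wcong r u u' -> wcong r v v' -> wcong r (u ++ v) (u' ++ v').

Section PresentedGroup.
Variables (X : choiceType) (r : word X -> word X -> Prop).

Definition wequiv (u v : word X) := `[< wcong r u v >].

Lemma wequiv_is_equiv : equiv_class_of wequiv.
Proof.
split=> [u|u v|v u w]; first by apply/asboolP; apply: WRefl.
  by apply/asboolP/asboolP; apply: WSym.
by move=> /asboolP uv /asboolP vw; apply/asboolP; apply: WTrans vw.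
Qed.

Canonical wequiv_equiv := EquivRelPack wequiv_is_equiv.
Canonical wequiv_encModRel := defaultEncModRel wequiv.

Definition pres := {eq_quot wequiv}.

HB.instance Definition _ := Choice.on pres.
HB.instance Definition _ : EqQuotient (word X) wequiv pres :=
  EqQuotient.on pres.

Lemma pres_eqP (u v : word X) :
  reflect (\pi_pres u = \pi_pres v) (wequiv u v).
Proof. exact: eqquotP. Qed.

Lemma wcong_repr (u : word X) : wcong r (repr (\pi_pres u)) u.
Proof. by apply/asboolP/pres_eqP; rewrite reprK. Qed.

Definition winv (u : word X) : word X := rev [seq (p.1, ~~ p.2) | p <- u].

Lemma winv_cat u v : winv (u ++ v) = winv v ++ winv u.
Proof. by rewrite /winv map_cat rev_cat. Qed.

Lemma winvK u : winv (winv u) = u.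
Proof.
rewrite /winv map_rev revK -map_comp -[RHS]map_id.
by apply: eq_map => -[x b] /=; rewrite negbK.
Qed.

Lemma wcong_Vr u : wcong r (u ++ winv u) [::].
Proof.
elim: u => [|[x b] u IHu]; first exact: WRefl.
rewrite -cat1s winv_cat -catA [u ++ _]catA.
apply: WTrans (WInv r x b); apply: (@WCat _ _ [:: _] [:: _]).
  exact: WRefl.
exact: (WCat IHu (WRefl _ _)).
Qed.

Lemma wcong_Vl u : wcong r (winv u ++ u) [::].
Proof. by rewrite -{2}[u]winvK; apply: wcong_Vr. Qed.

Lemma wcong_inv u v : wcong r u v -> wcong r (winv u) (winv v).
Proof.
move=> uv; rewrite -[winv u]cats0.
apply: WTrans (WCat (WRefl _ _) (WSym (wcong_Vr v))) _.
rewrite catA; apply: WTrans (WCat (WCat (WRefl _ _) (WSym uv)) (WRefl _ _)) _.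
exact: WTrans (WCat (wcong_Vl u) (WRefl _ _)) (WRefl _ _).
Qed.

Definition pone : pres := \pi_pres [::].
Definition pmul (a b : pres) : pres := \pi_pres (repr a ++ repr b).
Definition pinv (a : pres) : pres := \pi_pres (winv (repr a)).

Lemma pi_pmul u v : pmul (\pi_pres u) (\pi_pres v) = \pi_pres (u ++ v).
Proof.
by apply/pres_eqP/asboolP; apply: WCat; apply: wcong_repr.
Qed.

Lemma pi_pinv u : pinv (\pi_pres u) = \pi_pres (winv u).
Proof. by apply/pres_eqP/asboolP/wcong_inv/wcong_repr. Qed.

Fact pmulA : associative pmul.
Proof.
elim/quotW=> u; elim/quotW=> v; elim/quotW=> w.
by rewrite (pi_pmul v w) (pi_pmul u v) !pi_pmul catA.
Qed.

Fact pmul1 : left_id pone pmul.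
Proof. by elim/quotW=> u; rewrite pi_pmul. Qed.

Fact pmulr1 : right_id pone pmul.
Proof. by elim/quotW=> u; rewrite (pi_pmul u [::]) cats0. Qed.

Fact pmulV : left_inverse pone pinv pmul.
Proof.
elim/quotW=> u; rewrite pi_pinv pi_pmul.
by apply/pres_eqP/asboolP/wcong_Vl.
Qed.

Fact pmulrV : right_inverse pone pinv pmul.
Proof.
elim/quotW=> u; rewrite pi_pinv pi_pmul.
by apply/pres_eqP/asboolP/wcong_Vr.
Qed.

HB.instance Definition _ :=
  isGroup.Build pres pmulA pmul1 pmulr1 pmulV pmulrV.

Definition pgen (x : X) : pres := \pi_pres [:: (x, true)].

Lemma pi_cat u v : \pi_pres (u ++ v) = (\pi_pres u * \pi_pres v)%g.
Proof. by rewrite -[RHS]/(pmul _ _) pi_pmul. Qed.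

Lemma pi_pgenV x : \pi_pres [:: (x, false)] = (pgen x)^-1%g.
Proof. by rewrite -[RHS]/(pinv _) pi_pinv. Qed.

Lemma pres_ind (P : pres -> Prop) :
    P 1%g -> (forall x a, P a -> P (pgen x * a)%g) ->
    (forall x a, P a -> P ((pgen x)^-1 * a)%g) ->
  forall a, P a.
Proof.
move=> P1 PM PV; elim/quotW; elim=> [|[x b] u Pu]; first exact: P1.
by rewrite -cat1s pi_cat; case: b; rewrite ?pi_pgenV; [apply: PM|apply: PV].
Qed.

Section Lift.
Variables (H : groupType) (f : X -> H).

Definition weval (u : word X) : H :=
  foldr (fun p h => ((if p.2 then f p.1 else (f p.1)^-1) * h)%g) 1%g u.

Definition plift (a : pres) : H := weval (repr a).

Lemma weval_cat u v : weval (u ++ v) = (weval u * weval v)%g.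
Proof. by elim: u => [|p u IHu] /=; rewrite ?mul1g // IHu mulgA. Qed.

Lemma weval_nseq k x : weval (nseq k (x, true)) = (f x ^+ k)%g.
Proof. by elim: k => //= k ->; rewrite expgS. Qed.

(* The universal property: [plift] is the homomorphism extending [f] as soon as
   the relations hold in [H]. *)
Hypothesis f_rel : forall u v, r u v -> weval u = weval v.

Lemma weval_cong u v : wcong r u v -> weval u = weval v.
Proof.
elim=> {u v} [u v /f_rel//|x b|//|//|u v w _ -> _ -> //|u u' v v' _ IHu _ IHv].
  by case: b; rewrite /= mulg1 ?mulgV ?mulVg.
by rewrite !weval_cat IHu IHv.
Qed.

Lemma plift_pi u : plift (\pi_pres u) = weval u.
Proof. exact/weval_cong/wcong_repr. Qed.

Lemma plift_gen x : plift (pgen x) = f x.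
Proof. by rewrite plift_pi /= mulg1. Qed.

Lemma pliftM : {morph plift : a b / (a * b)%g}.
Proof.
elim/quotW=> u; elim/quotW=> v.
by rewrite -pi_cat !plift_pi weval_cat.
Qed.

Lemma plift1 : plift 1%g = 1%g.
Proof. exact: plift_pi [::]. Qed.

Lemma pliftV : {morph plift : a / (a^-1)%g}.
Proof.
move=> a; apply: (mulgI (plift a)).
by rewrite -pliftM !mulgV plift1.
Qed.

End Lift.

Lemma weval_pgen w : weval pgen w = \pi_pres w.
Proof.
elim: w => //= -[x b] w ->; rewrite -cat1s pi_cat.
by case: b => //=; rewrite pi_pgenV.
Qed.

Lemma pgen_rel u v : r u v -> weval pgen u = weval pgen v.
Proof. by rewrite !weval_pgen => uv; apply/pres_eqP/asboolP/WRel. Qed.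

End PresentedGroup.

Arguments pgen {X} r x.

Definition galg (K : fieldType) (G : groupType) : Type := {malg K[G]}.

Section GroupAlgebra.
Variables (K : fieldType) (G : groupType).

HB.instance Definition _ := GRing.Lmodule.on (galg K G).

Definition gbas (g : G) : galg K G := << g >>.

Implicit Types (a b c : galg K G).

(* Products are locked so that unification does not unfold them. *)
Fact gmul_key : unit. Proof. by []. Qed.
Definition gmul := locked_with gmul_key (fun a b : galg K G =>
  \sum_(g <- msupp a) \sum_(h <- msupp b) << a@_g * b@_h *g (g * h)%g >> : galg K G).

Lemma gmulE a b : gmul a b =
  \sum_(g <- msupp a) \sum_(h <- msupp b) << a@_g * b@_h *g (g * h)%g >>.
Proof. by rewrite /gmul unlock. Qed.

Lemma gmulw (d1 d2 : {fset G}) a b :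
  (msupp a `<=` d1)%fset -> (msupp b `<=` d2)%fset ->
  gmul a b =
    \sum_(g <- d1) \sum_(h <- d2) << a@_g * b@_h *g (g * h)%g >>.
Proof.
move=> le1 le2; rewrite gmulE (big_fset_incl _ le1) /=.
  apply/eq_bigr=> g _; apply/big_fset_incl => // h _ /mcoeff_outdom ->.
  by rewrite mulr0 monalgU0.
move=> g _ /mcoeff_outdom ag.
by rewrite big1 => // h _; rewrite ag mul0r monalgU0.
Qed.

Lemma gmulwl (d : {fset G}) a b : (msupp a `<=` d)%fset -> gmul a b =
  \sum_(g <- d) \sum_(h <- msupp b) << a@_g * b@_h *g (g * h)%g >>.
Proof. by move=> le; apply: gmulw. Qed.

Lemma gmulwr (d : {fset G}) a b : (msupp b `<=` d)%fset -> gmul a b =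
  \sum_(h <- d) \sum_(g <- msupp a) << a@_g * b@_h *g (g * h)%g >>.
Proof. by move=> le; rewrite (gmulw (fsubset_refl _) le) exchange_big. Qed.

Fact gmulDl : left_distributive gmul +%R.
Proof.
move=> a b c; rewrite [in RHS](gmulwl c (fsubsetUl _ (msupp b))).
rewrite [in RHS](gmulwl c (fsubsetUr (msupp a) _)).
rewrite (gmulwl c (msuppD_le _ _)) -big_split /=; apply/eq_bigr=> g _.
rewrite -big_split /=; apply/eq_bigr=> h _.
by rewrite mcoeffD mulrDl monalgUD.
Qed.

Fact gmulDr : right_distributive gmul +%R.
Proof.
move=> c a b; rewrite [in RHS](gmulwr c (fsubsetUl _ (msupp b))).
rewrite [in RHS](gmulwr c (fsubsetUr (msupp a) _)).
rewrite (gmulwr c (msuppD_le _ _)) -big_split /=; apply/eq_bigr=> g _.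
rewrite -big_split /=; apply/eq_bigr=> h _.
by rewrite mcoeffD mulrDr monalgUD.
Qed.

Fact gmul0a : left_zero 0 gmul.
Proof. by move=> a; rewrite gmulE msupp0 big_seq_fset0. Qed.

Fact gmula0 : right_zero 0 gmul.
Proof.
by move=> a; rewrite (gmulwr a (fsubset_refl _)) msupp0 big_seq_fset0.
Qed.

Lemma gmulUU x y g h :
  gmul << x *g g >> << y *g h >> = << x * y *g (g * h)%g >>.
Proof.
by rewrite (gmulw msuppU_le msuppU_le) !big_seq_fset1 !mcoeffUU.
Qed.

Lemma galg_ind (P : galg K G -> Prop) :
    P 0 -> (forall a b, P a -> P b -> P (a + b)) ->
    (forall x g, P << x *g g >>) -> forall a, P a.
Proof. by move=> P0 PD PU a; rewrite [a]monalgE; elim/big_ind: _. Qed.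

Fact gmulA : associative gmul.
Proof.
move=> a b c; elim/galg_ind: a => [|a a' IH IH'|x g].
- by rewrite !gmul0a.
- by rewrite !gmulDl IH IH'.
elim/galg_ind: b => [|b b' IH IH'|y h].
- by rewrite gmul0a gmula0 gmul0a.
- by rewrite gmulDl !gmulDr gmulDl IH IH'.
elim/galg_ind: c => [|c c' IH IH'|z k].
- by rewrite !gmula0.
- by rewrite !gmulDr IH IH'.
by rewrite !gmulUU mulrA mulgA.
Qed.

Fact gmul1a : left_id (gbas 1%g) gmul.
Proof.
move=> a; elim/galg_ind: a => [|a a' IH IH'|x g]; first exact: gmula0.
  by rewrite gmulDr IH IH'.
by rewrite gmulUU mul1r mul1g.
Qed.

Fact gmula1 : right_id (gbas 1%g) gmul.
Proof.
move=> a; elim/galg_ind: a => [|a a' IH IH'|x g]; first exact: gmul0a.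
  by rewrite gmulDl IH IH'.
by rewrite gmulUU mulr1 mulg1.
Qed.

Fact gone_neq0 : gbas 1%g != 0.
Proof. by rewrite /gbas monalgU_eq0 oner_eq0. Qed.

HB.instance Definition _ := GRing.Zmodule_isNzRing.Build (galg K G)
  gmulA gmul1a gmula1 gmulDl gmulDr gone_neq0.

Lemma mulgUU x y g h : (<< x *g g >> : galg K G) * << y *g h >> =
  << x * y *g (g * h)%g >>.
Proof. exact: gmulUU. Qed.

Lemma gscaleU x y g : x *: (<< y *g g >> : galg K G) = << x * y *g g >>.
Proof. by apply/malgP => h; rewrite mcoeffZ !mcoeffU mulrnAr. Qed.

Fact gscaleAl (x : K) a b : x *: (a * b) = (x *: a) * b.
Proof.
elim/galg_ind: a => [|a a' IH IH'|y g]; first by rewrite !(mul0r, scaler0).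
  by rewrite scalerDr !mulrDl scalerDr IH IH'.
elim/galg_ind: b => [|b b' IH IH'|z h]; first by rewrite !(mulr0, scaler0).
  by rewrite !mulrDr scalerDr IH IH'.
by rewrite mulgUU !gscaleU mulgUU mulrA.
Qed.

HB.instance Definition _ := GRing.Lmodule_isLalgebra.Build K (galg K G) gscaleAl.

Fact gscaleAr (x : K) a b : x *: (a * b) = a * (x *: b).
Proof.
elim/galg_ind: a => [|a a' IH IH'|y g]; first by rewrite !(mul0r, scaler0).
  by rewrite !mulrDl scalerDr IH IH'.
elim/galg_ind: b => [|b b' IH IH'|z h]; first by rewrite !(mulr0, scaler0).
  by rewrite scalerDr !mulrDr scalerDr IH IH'.
by rewrite mulgUU !gscaleU mulgUU mulrCA.
Qed.

HB.instance Definition _ := GRing.Lalgebra_isAlgebra.Build K (galg K G) gscaleAr.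

Lemma gbasM g h : gbas (g * h)%g = gbas g * gbas h.
Proof. by rewrite mulgUU mulr1. Qed.

Lemma gbas1 : gbas 1%g = 1.
Proof. by []. Qed.

Lemma galgE a : a = \sum_(g <- msupp a) a@_g *: gbas g.
Proof.
by rewrite {1}[a]monalgE; apply/eq_bigr => g _; rewrite gscaleU mulr1.
Qed.

End GroupAlgebra.

Section GroupAlgebraLift.
Variables (K : fieldType) (G : groupType) (V : lmodType K) (f : G -> V).

Definition galg_lift (a : galg K G) : V := \sum_(g <- msupp a) a@_g *: f g.

Lemma galg_liftEw (d : {fset G}) a : (msupp a `<=` d)%fset ->
  galg_lift a = \sum_(g <- d) a@_g *: f g.
Proof.
move=> le; rewrite /galg_lift (big_fset_incl _ le) // => g _ /mcoeff_outdom ->.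
by rewrite scale0r.
Qed.

Fact galg_lift_is_linear : linear galg_lift.
Proof.
move=> x a b.
pose d := (msupp a `|` msupp b)%fset.
rewrite (@galg_liftEw d a) ?fsubsetUl // (@galg_liftEw d b) ?fsubsetUr //.
rewrite (@galg_liftEw d (x *: a + b)); last first.
  apply: fsubset_trans (msuppD_le _ _) _.
  by apply: fsetSU; apply: msuppZ_le.
rewrite scaler_sumr -big_split; apply/eq_bigr => g _ /=.
by rewrite mcoeffD mcoeffZ scalerDl scalerA.
Qed.

HB.instance Definition _ :=
  GRing.isLinear.Build K (galg K G) V *:%R galg_lift galg_lift_is_linear.

Lemma galg_lift0 : galg_lift 0 = 0.
Proof. exact: raddf0. Qed.

Lemma galg_liftD : {morph galg_lift : a b / a + b}.
Proof. exact: raddfD. Qed.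

Lemma galg_liftB : {morph galg_lift : a b / a - b}.
Proof. exact: raddfB. Qed.

Lemma galg_lift_sum I (s : seq I) (F : I -> galg K G) :
  galg_lift (\sum_(i <- s) F i) = \sum_(i <- s) galg_lift (F i).
Proof. exact: raddf_sum. Qed.

Lemma galg_liftZ x : {morph galg_lift : a / x *: a}.
Proof. exact: linearZ. Qed.

Lemma galg_liftU x g : galg_lift << x *g g >> = x *: f g.
Proof.
by rewrite (galg_liftEw msuppU_le) big_seq_fset1 mcoeffUU.
Qed.

Lemma galg_lift_gbas g : galg_lift (gbas K g) = f g.
Proof.
by rewrite (galg_liftEw msuppU_le) big_seq_fset1 mcoeffUU scale1r.
Qed.

Lemma galg_liftM (op : V -> V -> V) :
    (forall v, linear (op v)) -> (forall v, linear (op^~ v)) ->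
    (forall g h, f (g * h)%g = op (f g) (f h)) ->
  forall a b, galg_lift (a * b) = op (galg_lift a) (galg_lift b).
Proof.
move=> opr opl fM.
have op0 v : op v 0 = 0
  by have := opr v (-1) 0 0; rewrite scaler0 scaleN1r !addr0 addNr.
have op0' v : op 0 v = 0
  by have := opl v (-1) 0 0; rewrite scaler0 scaleN1r !addr0 addNr.
have opD v : {morph op v : u w / u + w} by move=> u w; have := opr v 1 u w; rewrite !scale1r.
have opD' v : {morph op^~ v : u w / u + w} by move=> u w; have := opl v 1 u w; rewrite !scale1r.
have opZ v c w : op v (c *: w) = c *: op v w
  by have := opr v c w 0; rewrite op0 !addr0.
have opZ' v c w : op (c *: w) v = c *: op w v
  by have := opl v c w 0; rewrite op0' !addr0.
move=> a b; elim/galg_ind: a => [|a a' IH IH'|x g].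
- by rewrite mul0r galg_lift0 op0'.
- by rewrite mulrDl !galg_liftD opD' IH IH'.
elim/galg_ind: b => [|b b' IH IH'|y k].
- by rewrite mulr0 galg_lift0 op0.
- by rewrite mulrDr !galg_liftD opD IH IH'.
by rewrite mulgUU !galg_liftU fM opZ opZ' scalerA mulrC.
Qed.

End GroupAlgebraLift.

Inductive ideal_span (A : pzRingType) (S : A -> Prop) : A -> Prop :=
| Ideal0 : ideal_span S 0
| IdealD u v : ideal_span S u -> ideal_span S v -> ideal_span S (u + v)
| IdealM a u b : S u -> ideal_span S (a * u * b).

Section AlgebraQuotient.
Variables (K : fieldType) (A : algType K) (S : A -> Prop).

Definition ideal_pred (a : A) : bool := `[< ideal_span S a >].

Lemma ideal_spanMlr a b u : ideal_span S u -> ideal_span S (a * u * b).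
Proof.
elim=> {u} [|u v _ IHu _ IHv|a' u b' Su].
- by rewrite mulr0 mul0r; apply: Ideal0.
- by rewrite mulrDr mulrDl; apply: IdealD.
- by rewrite !mulrA -mulrA; apply: IdealM.
Qed.

Fact ideal_pred_zmod_closed : zmod_closed ideal_pred.
Proof.
split=> [|u v /asboolP Iu /asboolP Iv]; apply/asboolP; first exact: Ideal0.
apply: IdealD => //.
by rewrite -[- v]mulr1 -mulN1r; apply: ideal_spanMlr.
Qed.

HB.instance Definition _ :=
  GRing.isZmodClosed.Build A ideal_pred ideal_pred_zmod_closed.

Lemma ideal_predMl a u : u \in ideal_pred -> a * u \in ideal_pred.
Proof.
move=> /asboolP Iu; apply/asboolP.
by rewrite -[_ * _]mulr1; apply: ideal_spanMlr.
Qed.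

Lemma ideal_predMr u b : u \in ideal_pred -> u * b \in ideal_pred.
Proof.
move=> /asboolP Iu; apply/asboolP.
by rewrite -[u]mul1r; apply: ideal_spanMlr.
Qed.

Definition ideal_closed : zmodClosed A :=
  GRing.ZmodClosed.clone A ideal_pred _.

Definition qalg : Type := {ideal_quot ideal_closed}.

HB.instance Definition _ := GRing.Zmodule.on qalg.
HB.instance Definition _ :
  @ZmodQuotient A (Quotient.equiv ideal_closed) 0 -%R +%R qalg :=
  ZmodQuotient.on qalg.

Definition qpi (a : A) : qalg := \pi_qalg a.

Lemma qpi_eq a b : (qpi a = qpi b) <-> (a - b \in ideal_pred).
Proof.
rewrite -[X in _ <-> is_true X]/(a - b \in ideal_closed).
by rewrite Quotient.idealrBE; split=> [qab|/eqP //]; apply/eqP.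
Qed.

Lemma qreprK (x : qalg) : qpi (repr x) = x.
Proof. exact: reprK. Qed.

Lemma qpiB : {morph qpi : a b / a - b}.
Proof. exact: raddfB. Qed.

Lemma qpiD : {morph qpi : a b / a + b}.
Proof. exact: raddfD. Qed.

Lemma qrepr_qpi a : repr (qpi a) - a \in ideal_pred.
Proof. by apply/qpi_eq; rewrite qreprK. Qed.

Fact qmul_key : unit. Proof. by []. Qed.
Definition qmul := locked_with qmul_key (fun x y : qalg =>
  qpi (repr x * repr y)).

Lemma qpi_mul a b : qmul (qpi a) (qpi b) = qpi (a * b).
Proof.
rewrite /qmul unlock.
apply/qpi_eq.
have -> : repr (qpi a) * repr (qpi b) - a * b =
    (repr (qpi a) - a) * repr (qpi b) + a * (repr (qpi b) - b).
  by rewrite mulrBl mulrBr addrA subrK.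
apply: (@rpredD _ ideal_closed).
  by apply: ideal_predMr; apply: qrepr_qpi.
by apply: ideal_predMl; apply: qrepr_qpi.
Qed.

Fact qmulA : associative qmul.
Proof.
move=> x y z; rewrite -[x]qreprK -[y]qreprK -[z]qreprK !qpi_mul.
by rewrite mulrA.
Qed.

Fact qmul1l : left_id (qpi 1) qmul.
Proof. by move=> x; rewrite -[x]qreprK qpi_mul mul1r. Qed.

Fact qmul1r : right_id (qpi 1) qmul.
Proof. by move=> x; rewrite -[x]qreprK qpi_mul mulr1. Qed.

Fact qmulDl : left_distributive qmul +%R.
Proof.
move=> x y z; rewrite -[x]qreprK -[y]qreprK -[z]qreprK -qpiD !qpi_mul -qpiD.
by rewrite mulrDl.
Qed.

Fact qmulDr : right_distributive qmul +%R.
Proof.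
move=> x y z; rewrite -[x]qreprK -[y]qreprK -[z]qreprK -qpiD !qpi_mul -qpiD.
by rewrite mulrDr.
Qed.

HB.instance Definition _ :=
  GRing.Zmodule_isPzRing.Build qalg qmulA qmul1l qmul1r qmulDl qmulDr.

Fact qscale_key : unit. Proof. by []. Qed.
Definition qscale := locked_with qscale_key (fun (c : K) (x : qalg) =>
  qpi (c *: repr x)).

Lemma qpi_scale c a : qscale c (qpi a) = qpi (c *: a).
Proof.
rewrite /qscale unlock.
by apply/qpi_eq; rewrite -scalerBr -mulr_algl ideal_predMl ?qrepr_qpi.
Qed.

Fact qscaleA b c x : qscale b (qscale c x) = qscale (b * c) x.
Proof. by rewrite -[x]qreprK !qpi_scale scalerA. Qed.

Fact qscale1 : left_id 1 qscale.
Proof. by move=> x; rewrite -[x]qreprK qpi_scale scale1r. Qed.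

Fact qscaleDr : right_distributive qscale +%R.
Proof.
move=> c x y; rewrite -[x]qreprK -[y]qreprK -qpiD !qpi_scale -qpiD.
by rewrite scalerDr.
Qed.

Fact qscaleDl x : {morph qscale^~ x : b c / b + c}.
Proof. by move=> b c; rewrite -[x]qreprK !qpi_scale -qpiD scalerDl. Qed.

HB.instance Definition _ :=
  GRing.Zmodule_isLmodule.Build K qalg qscaleA qscale1 qscaleDr qscaleDl.

Fact qpi_is_linear : linear qpi.
Proof. by move=> c a b; rewrite qpiD -qpi_scale. Qed.

HB.instance Definition _ :=
  GRing.isLinear.Build K A qalg *:%R qpi qpi_is_linear.

Lemma qpiM : {morph qpi : a b / a * b}.
Proof. by move=> a b; rewrite -[RHS]/(qmul _ _) qpi_mul. Qed.

Lemma qpi1 : qpi 1 = 1.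
Proof. by []. Qed.

Lemma qpiZ c a : c *: qpi a = qpi (c *: a).
Proof. exact: qpi_scale. Qed.

Lemma qscalerAl (c : K) (x y : qalg) : c *: (x * y) = (c *: x) * y.
Proof.
by rewrite -[x]qreprK -[y]qreprK -qpiM !qpiZ -qpiM scalerAl.
Qed.

Lemma qscalerAr (c : K) (x y : qalg) : c *: (x * y) = x * (c *: y).
Proof.
by rewrite -[x]qreprK -[y]qreprK -qpiM !qpiZ -qpiM scalerAr.
Qed.

Definition qlift (T : Type) (h : A -> T) (x : qalg) : T := h (repr x).

(* A linear map that vanishes on the ideal factors through the quotient. *)
Lemma qlift_qpi (V : lmodType K) (h : {linear A -> V}) :
  (forall a u b, S u -> h (a * u * b) = 0) ->
  forall a, qlift h (qpi a) = h a.
Proof.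
move=> hS a; apply/eqP; rewrite -subr_eq0 -raddfB; apply/eqP.
have /asboolP := qrepr_qpi a; elim=> [|u v _ hu _ hv|b u c Su]; last exact: hS.
- by rewrite raddf0.
- by rewrite raddfD hu hv addr0.
Qed.

Lemma qpi_rel a : S a -> qpi a = 0.
Proof.
move=> Sa; rewrite -(linear0 qpi); apply/qpi_eq; rewrite subr0.
by apply/asboolP; rewrite -[a]mul1r -[_ * a]mulr1; apply: IdealM.
Qed.

End AlgebraQuotient.

Arguments qpi {K A} S a.

(* Strands and generators are numbered from 0: the index i : 'I_n.-1 stands for
   sigma_{i+1}, which crosses the strands i and i+1, and j : 'I_n for
   t_{j+1}. *)

Section Braids.
Variable n : nat.

Fact strand_lo_subproof (i : 'I_n.-1) : (i < n)%N.
Proof. exact: leq_trans (ltn_ord i) (leq_pred n). Qed.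

Fact strand_hi_subproof (i : 'I_n.-1) : (i.+1 < n)%N.
Proof. by case: n i => [|m] [j lt_j]. Qed.

Definition strand_lo (i : 'I_n.-1) : 'I_n := Ordinal (strand_lo_subproof i).
Definition strand_hi (i : 'I_n.-1) : 'I_n := Ordinal (strand_hi_subproof i).

Inductive braid_rel : word 'I_n.-1 -> word 'I_n.-1 -> Prop :=
| BFar (i j : 'I_n.-1) : (i.+1 < j)%N ->
    braid_rel [:: (i, true); (j, true)] [:: (j, true); (i, true)]
| BNear (i j : 'I_n.-1) : j = i.+1 :> nat ->
    braid_rel [:: (i, true); (j, true); (i, true)]
              [:: (j, true); (i, true); (j, true)].

Definition braid := pres braid_rel.
HB.instance Definition _ := Group.on braid.

Definition sigma (i : 'I_n.-1) : braid := pgen braid_rel i.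

Definition mirror : braid -> braid := plift (fun i => (sigma i)^-1%g).

Lemma mirror_rel u v : braid_rel u v ->
  weval (fun i => (sigma i)^-1%g) u = weval (fun i => (sigma i)^-1%g) v.
Proof.
case=> [i j ij|i j ij] /=; rewrite !mulg1 -!invgM; congr (_^-1)%g.
  by have := pgen_rel (BFar ij); rewrite /= !mulg1 => ->.
by have := pgen_rel (BNear ij); rewrite /= !mulg1 -!mulgA => ->.
Qed.

Lemma mirror_sigma i : mirror (sigma i) = (sigma i)^-1%g.
Proof. exact: plift_gen mirror_rel i. Qed.

Lemma mirrorV : {morph mirror : a / (a^-1)%g}.
Proof. exact: pliftV mirror_rel. Qed.

Lemma mirrorM : {morph mirror : a b / (a * b)%g}.
Proof. exact: pliftM mirror_rel. Qed.

Lemma mirrorK : involutive mirror.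
Proof.
elim/pres_ind => [|i a IH|i a IH].
- by rewrite /mirror !(plift1 mirror_rel).
- by rewrite !mirrorM IH mirror_sigma mirrorV mirror_sigma invgK.
- by rewrite !mirrorM IH !mirrorV mirror_sigma mirrorV mirror_sigma invgK.
Qed.

End Braids.

Section FramedBraids.
Variables d n : nat.

(* For d = 0 the last relation is void, and the group is the framed braid
   group of Z-framings. *)
Inductive framed_rel :
    word ('I_n.-1 + 'I_n) -> word ('I_n.-1 + 'I_n) -> Prop :=
| FFar (i j : 'I_n.-1) : (i.+1 < j)%N ->
    framed_rel [:: (inl i, true); (inl j, true)]
               [:: (inl j, true); (inl i, true)]
| FNear (i j : 'I_n.-1) : j = i.+1 :> nat ->
    framed_rel [:: (inl i, true); (inl j, true); (inl i, true)]
               [:: (inl j, true); (inl i, true); (inl j, true)]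
| FComm (j k : 'I_n) :
    framed_rel [:: (inr j, true); (inr k, true)]
               [:: (inr k, true); (inr j, true)]
| FSwap (i : 'I_n.-1) (j : 'I_n) :
    framed_rel [:: (inr j, true); (inl i, true)]
      [:: (inl i, true); (inr (tperm (strand_lo i) (strand_hi i) j), true)]
| FMod (j : 'I_n) : framed_rel (nseq d (inr j, true)) [::].

Definition framed := pres framed_rel.
HB.instance Definition _ := Group.on framed.

Definition fsigma (i : 'I_n.-1) : framed := pgen framed_rel (inl i).
Definition ft (j : 'I_n) : framed := pgen framed_rel (inr j).

Definition braid_framed : braid n -> framed := plift fsigma.

Lemma fsigma_rel u v : braid_rel u v -> weval fsigma u = weval fsigma v.
Proof.
case=> [i j ij|i j ij]; first exact: (pgen_rel (FFar ij)).
exact: (pgen_rel (FNear ij)).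
Qed.

Lemma braid_framed_sigma i : braid_framed (sigma i) = fsigma i.
Proof. exact: plift_gen fsigma_rel i. Qed.

Lemma braid_framedM : {morph braid_framed : a b / (a * b)%g}.
Proof. exact: pliftM fsigma_rel. Qed.

End FramedBraids.

Section AddStrand.
Variables d n : nat.

Definition add_strand_gen (x : 'I_n.-1 + 'I_n) : framed d n.+1 :=
  match x with
  | inl i => @fsigma d n.+1 (widen_ord (leq_pred n) i)
  | inr j => ft d (widen_ord (leqnSn n) j)
  end.

Definition add_strand : framed d n -> framed d n.+1 := plift add_strand_gen.

Lemma strand_lo_widen (i : 'I_n.-1) : widen_ord (leqnSn n) (strand_lo i) =
  @strand_lo n.+1 (widen_ord (leq_pred n) i).
Proof. exact: val_inj. Qed.

Lemma strand_hi_widen (i : 'I_n.-1) : widen_ord (leqnSn n) (strand_hi i) =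
  @strand_hi n.+1 (widen_ord (leq_pred n) i).
Proof. exact: val_inj. Qed.

Lemma add_strand_rel u v : framed_rel d u v ->
  weval add_strand_gen u = weval add_strand_gen v.
Proof.
case=> [i j ij|i j ij|j k|i j|j].
- exact: (pgen_rel (@FFar d n.+1 (widen_ord (leq_pred n) i)
                                    (widen_ord (leq_pred n) j) ij)).
- exact: (pgen_rel (@FNear d n.+1 (widen_ord (leq_pred n) i)
                                     (widen_ord (leq_pred n) j) ij)).
- exact: (pgen_rel (@FComm d n.+1 (widen_ord (leqnSn n) j)
                                     (widen_ord (leqnSn n) k))).
- have := pgen_rel (@FSwap d n.+1 (widen_ord (leq_pred n) i)
                                     (widen_ord (leqnSn n) j)).
  have -> : tperm (strand_lo (widen_ord (leq_pred n) i : 'I_n.+1.-1))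
              (strand_hi (widen_ord (leq_pred n) i : 'I_n.+1.-1))
              (widen_ord (leqnSn n) j) =
            widen_ord (leqnSn n) (tperm (strand_lo i) (strand_hi i) j).
    have winj : injective (widen_ord (leqnSn n)).
      by move=> k l /(congr1 val) /= kl; apply: val_inj.
    by rewrite (inj_tperm _ _ _ winj) strand_lo_widen strand_hi_widen.
  by [].
- have := pgen_rel (@FMod d n.+1 (widen_ord (leqnSn n) j)).
  by rewrite !weval_nseq.
Qed.

Lemma add_strandM : {morph add_strand : a b / (a * b)%g}.
Proof. exact: pliftM add_strand_rel. Qed.

Lemma add_strand1 : add_strand 1%g = 1%g.
Proof. exact: plift1 add_strand_rel. Qed.

Lemma add_strandV : {morph add_strand : a / (a^-1)%g}.
Proof. exact: pliftV add_strand_rel. Qed.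

Lemma add_strandX k : {morph add_strand : a / (a ^+ k)%g}.
Proof.
move=> a; elim: k => [|k IH]; first exact: add_strand1.
by rewrite !expgS add_strandM IH.
Qed.

Lemma add_strand_fsigma i :
  add_strand (fsigma d i) = @fsigma d n.+1 (widen_ord (leq_pred n) i).
Proof. exact: plift_gen add_strand_rel _. Qed.

Lemma add_strand_ft j : add_strand (ft d j) = ft d (widen_ord (leqnSn n) j).
Proof. exact: plift_gen add_strand_rel _. Qed.

End AddStrand.

Section YokonumaHecke.
Variables (R : realType) (d : nat).
Local Notation C := (R[i]).

Definition e_idem n (i : 'I_n.-1) : galg C (framed d n) :=
  d%:R^-1 *:
    \sum_(1 <= s < d.+1)
      gbas C (ft d (strand_lo i) ^+ s * ft d (strand_hi i) ^- s)%g.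

Definition yh_rel n (q : C) (a : galg C (framed d n)) : Prop :=
  exists i : 'I_n.-1,
    a = gbas C (fsigma d i) ^+ 2 - 1
        - (q - q^-1) *: (e_idem i * gbas C (fsigma d i)).

Definition Y n (q : C) : Type := qalg (@yh_rel n q).

HB.instance Definition _ n q := GRing.PzRing.on (Y n q).
HB.instance Definition _ n q := GRing.Lmodule.on (Y n q).

Definition Yof n q (g : framed d n) : Y n q := qpi (@yh_rel n q) (gbas C g).

Lemma YofM n q (g h : framed d n) : Yof q (g * h)%g = Yof q g * Yof q h.
Proof. by rewrite /Yof gbasM qpiM. Qed.

Lemma Yof1 n q : Yof q (1%g : framed d n) = 1.
Proof. by []. Qed.

(* The algebra map induced by adding a strand: see [Yincl_qpi], [YinclM]. *)
Definition Yincl n q : Y n q -> Y n.+1 q :=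
  qlift (galg_lift (fun g => Yof q (add_strand g))).

Lemma galg_add_strandM n q (a b : galg C (framed d n)) :
  galg_lift (fun g => Yof q (add_strand g)) (a * b) =
  galg_lift (fun g => Yof q (add_strand g)) a *
  galg_lift (fun g => Yof q (add_strand g)) b.
Proof.
apply: (@galg_liftM C (framed d n) (Y n.+1 q) _ (fun u v => u * v))
  => [v c u w|v c u w|g h].
- by rewrite mulrDr qscalerAr.
- by rewrite mulrDl qscalerAl.
by rewrite add_strandM YofM.
Qed.

Lemma Yincl_qpi n q a :
  Yincl (qpi (@yh_rel n q) a) =
  galg_lift (fun g => Yof q (add_strand g)) a.
Proof.
apply: qlift_qpi => b _ c [i ->].
rewrite /= !galg_add_strandM; set h := galg_lift _.
suff -> : h (gbas C (fsigma d i) ^+ 2 - 1 -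
    (q - q^-1) *: (e_idem i * gbas C (fsigma d i))) = 0.
  by rewrite mulr0 mul0r.
rewrite /h galg_liftB galg_liftB galg_liftZ expr2.
rewrite galg_add_strandM galg_add_strandM.
rewrite -gbas1 galg_lift_gbas galg_lift_gbas.
rewrite add_strand_fsigma add_strand1.
have -> : galg_lift (fun g => Yof q (add_strand g)) (e_idem i) =
    qpi (@yh_rel n.+1 q) (@e_idem n.+1 (widen_ord (leq_pred n) i)).
  rewrite /e_idem galg_liftZ galg_lift_sum -qpiZ; congr (_ *: _).
  rewrite (linear_sum (qpi (@yh_rel n.+1 q))).
  apply: eq_bigr => s _; rewrite galg_lift_gbas add_strandM.
  rewrite add_strandV !add_strandX !add_strand_ft.
  by rewrite strand_lo_widen strand_hi_widen.
rewrite /Yof -!qpiM -linearZ -!linearB /=.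
apply: qpi_rel; exists (widen_ord (leq_pred n) i).
by rewrite expr2.
Qed.

Lemma Yincl_Yof n q (g : framed d n) : Yincl (Yof q g) = Yof q (add_strand g).
Proof. by rewrite Yincl_qpi galg_lift_gbas. Qed.

Lemma YinclM n q : {morph @Yincl n q : a b / a * b}.
Proof.
move=> a b; rewrite -[a]qreprK -[b]qreprK -[X in Yincl X]qpiM !Yincl_qpi.
exact: galg_add_strandM.
Qed.

Lemma Yincl1 n q : Yincl (1 : Y n q) = 1.
Proof. by have := Yincl_Yof q (1%g : framed d n); rewrite add_strand1. Qed.

Fact Yincl_linear n q : linear (@Yincl n q).
Proof.
move=> c a b; rewrite -[a]qreprK -[b]qreprK.
by rewrite -[X in Yincl X]/(c *: qpi _ _ + qpi _ _) -linearP !Yincl_qpi linearP.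
Qed.

HB.instance Definition _ n q := GRing.isLinear.Build C (Y n q) (Y n.+1 q) *:%R
  (@Yincl n q) (@Yincl_linear n q).

End YokonumaHecke.

From mathcomp Require Import mpoly.

(* C[z, x_1, ..., x_{d-1}]: the variable of index 0 is z, and the variable of
   index s is x_s for 0 < s < d. *)
Notation trace_ring R d := {mpoly (R[i])[d.-1.+1]}.

Section Traces.
Variables (R : realType) (d : nat).
Local Notation C := (R[i]).

(* A linear map on the union of the algebras Y_{d,n}(q) is a family of linear
   maps compatible with the inclusions. *)
Record juyumaya_trace (q : C)
    (tr : forall n, {linear Y d n q -> trace_ring R d}) : Prop := JuyumayaTrace {
  jtr_incl n (a : Y d n q) : tr n.+1 (Yincl a) = tr n a;
  jtr_comm n (a b : Y d n q) : tr n (a * b) = tr n (b * a);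
  jtr_1 n : tr n 1 = 1;
  jtr_sigma n (a : Y d n.+1 q) :
    tr n.+2 (Yincl a * Yof q (@fsigma d n.+2 ord_max)) =
      'X_ord0 * tr n.+1 a;
  jtr_t n (a : Y d n q) s : (0 < s < d)%N ->
    tr n.+1 (Yincl a * Yof q (@ft d n.+1 ord_max ^+ s)%g) =
      'X_(inord s) * tr n a
}.

Definition expi (t : R) : C := (trigo.cos t +i* trigo.sin t)%C.

Section Specialization.
Variable D : {set 'I_d}.

(* The k-th entry of Gerardin's solution X_D; elements of Z/dZ are given by
   their representatives in {0, ..., d-1}. *)
Definition x_sol (k : nat) : C :=
  #|D|%:R^-1 *
    \sum_(m in D) expi (2%:R * trigo.pi * (k * m)%:R / d%:R).

Definition specialize (p : trace_ring R d) : {poly C} :=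
  mmap polyC (fun i => if i == ord0 then 'X else (x_sol i)%:P) p.

(* E_D, the value of tr_{d,D} at every e_i. *)
Definition E_sol : C := #|D|%:R^-1.

Variable tr : forall (q : C) n, {linear Y d n q -> trace_ring R d}.

(* tr_{d,D}(q, z)(alpha), as a polynomial in z for a given nonzero number q.
   The value at q^-1 of the expression in q and z is the trace computed in
   Y_{d,n}(q^-1). *)
Definition trD n (q : C) (alpha : braid n) : {poly C} :=
  specialize (tr q n (Yof q (braid_framed d alpha))).

(* lambda_D = (z - (q - q^-1) E_D) / z solved for z; meaningful when
   q^2 != 1 and lambda_D is neither 0 nor 1. *)
Definition z_of_lambda (q lam : C) : C := (q - q^-1) * E_sol / (1 - lam).

Definition trD_lambda n (q lam : C) (alpha : braid n) : C :=
  (trD q alpha).[z_of_lambda q lam].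

End Specialization.
End Traces.

(* Main.v *)
Require Import Defs.
From HB Require Import structures.
From mathcomp Require Import all_boot all_order all_algebra.
From mathcomp Require Import boolp reals complex mpoly.
From mathcomp Require Import perm ring lra.

(** The mirror image is handled by a homomorphism between two Yokonuma-Hecke
algebras. In Y(q) the quadratic relation gives g^-1 = g - (q - q^-1) e, hence
g^-2 = 1 - (q - q^-1) e g^-1: the inverses of the braid generators satisfy the
quadratic relation of parameter q^-1. So g |-> g^-1, t |-> t defines a
homomorphism [Ymirror] from Y(q) to Y(q^-1), and it sends the image of the
mirror of a braid alpha to the image of alpha.

Pulling the specialized trace of Y(q^-1) back along [Ymirror] yields a linear
form on the tower Y(q) that is again a Markov trace with the same framing
parameters x_k; only the parameter of the last crossing changes, because
  tr(a g_n^-1) = tr(a g_n) + (q - q^-1) tr(a e_n) = (z + (q - q^-1) E_D) tr(a),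
where g_n and e_n live in Y(q^-1) ([markov_trace_mirror]). Substituting
z - (q - q^-1) E_D for z brings this parameter back to z, and a Markov trace is
determined by its parameters ([markov_trace_unique]), so the result is the
specialized trace of Y(q). This is the first formula; the second one is the
same identity evaluated at z = (q - q^-1) E_D / (1 - lambda_D).

Two facts carry the argument. The first is the spanning theorem [markov_spanP]:
every element of Y_{n+1} is a combination of elements a t_{n+1}^k and a g_n c
with a, c in Y_n. Uniqueness of Markov traces follows at once. The second is
the factorization tr(a e_n) = E_D tr(a) for all a in Y_n ([mtr_e]). It holds
because the x_k solve the E-system: by the spanning theorem and induction on
the number of strands, it reduces to elements a = b t_n^k with b in Y_{n-1},
where it is the k-th equation of the system. That the parameters x_k attached
to D solve the E-system is the orthogonality of the powers of a primitive d-th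
root of unity ([x_sol_E_system]). *)

Set Implicit Arguments.
Unset Strict Implicit.
Unset Printing Implicit Defensive.

Import GRing.Theory Num.Theory.

Local Open Scope ring_scope.

(** * The framed braid group modulo d and its mirror automorphism *)

Section FramedGroup.
Variables d n : nat.

Lemma ft_expd (j : 'I_n) : (ft d j ^+ d = 1)%g.
Proof. by have := pgen_rel (FMod d j); rewrite weval_nseq. Qed.

Lemma ft_expNn (d_gt0 : (0 < d)%N) (j : 'I_n) s :
  (ft d j ^- s = ft d j ^+ (d.-1 * s))%g.
Proof.
apply: (mulgI (ft d j ^+ s)%g); rewrite mulgV -expgnDr -mulSn prednK //.
by rewrite expgnA ft_expd expg1n.
Qed.

Lemma ft_comm (j k : 'I_n) : commute (ft d j) (ft d k).
Proof. by have := pgen_rel (FComm d j k); rewrite /= !mulg1. Qed.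

Lemma ft_fsigma (i : 'I_n.-1) (j : 'I_n) :
  (ft d j * fsigma d i =
   fsigma d i * ft d (tperm (strand_lo i) (strand_hi i) j))%g.
Proof. by have := pgen_rel (FSwap d i j); rewrite /= !mulg1. Qed.

Lemma ftX_fsigma (i : 'I_n.-1) (j : 'I_n) k :
  (ft d j ^+ k * fsigma d i =
   fsigma d i * ft d (tperm (strand_lo i) (strand_hi i) j) ^+ k)%g.
Proof.
elim: k => [|k IH]; first by rewrite mul1g mulg1.
by rewrite !expgS -mulgA IH !mulgA ft_fsigma.
Qed.

Lemma ft_loX_fsigma (i : 'I_n.-1) k :
  (ft d (strand_lo i) ^+ k * fsigma d i =
   fsigma d i * ft d (strand_hi i) ^+ k)%g.
Proof. by rewrite ftX_fsigma tpermL. Qed.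

Lemma ft_hiX_fsigma (i : 'I_n.-1) k :
  (ft d (strand_hi i) ^+ k * fsigma d i =
   fsigma d i * ft d (strand_lo i) ^+ k)%g.
Proof. by rewrite ftX_fsigma tpermR. Qed.

Lemma framed_ind (P : framed d n -> Prop) :
    P 1%g -> (forall a b, P a -> P b -> P (a * b)%g) ->
    (forall a, P a -> P a^-1%g) ->
    (forall i, P (fsigma d i)) -> (forall j, P (ft d j)) ->
  forall a, P a.
Proof.
move=> P1 PM PV Ps Pt; have Pg x : P (pgen (framed_rel d (n:=n)) x) by case: x.
by apply: pres_ind => // x a Pa; apply: PM => //; apply: PV.
Qed.

Definition framed_mirror_gen (x : 'I_n.-1 + 'I_n) : framed d n :=
  match x with inl i => (fsigma d i)^-1%g | inr j => ft d j end.

Definition framed_mirror : framed d n -> framed d n := plift framed_mirror_gen.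

Lemma framed_mirror_rel u v : framed_rel d u v ->
  weval framed_mirror_gen u = weval framed_mirror_gen v.
Proof.
case=> [i j ij|i j ij|j k|i j|j] /=; rewrite ?mulg1.
- rewrite -!invgM; congr (_^-1)%g.
  by have := pgen_rel (FFar d ij); rewrite /= !mulg1 => ->.
- rewrite -!invgM; congr (_^-1)%g.
  by have := pgen_rel (FNear d ij); rewrite /= !mulg1 -!mulgA => ->.
- exact: ft_comm.
- apply: (mulgI (fsigma d i)); rewrite !mulgA mulgV mul1g.
  by rewrite -{1}[j](tpermK (strand_lo i) (strand_hi i)) -ft_fsigma mulgK.
- by rewrite weval_nseq; apply: ft_expd.
Qed.

Lemma framed_mirrorM : {morph framed_mirror : a b / (a * b)%g}.
Proof. exact: pliftM framed_mirror_rel. Qed.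

Lemma framed_mirror1 : framed_mirror 1%g = 1%g.
Proof. exact: plift1 framed_mirror_rel. Qed.

Lemma framed_mirrorV : {morph framed_mirror : a / (a^-1)%g}.
Proof. exact: pliftV framed_mirror_rel. Qed.

Lemma framed_mirror_fsigma i : framed_mirror (fsigma d i) = (fsigma d i)^-1%g.
Proof. exact: plift_gen framed_mirror_rel _. Qed.

Lemma framed_mirror_ft j : framed_mirror (ft d j) = ft d j.
Proof. exact: plift_gen framed_mirror_rel _. Qed.

Lemma framed_mirror_ftX j k : framed_mirror (ft d j ^+ k)%g = (ft d j ^+ k)%g.
Proof.
elim: k => [|k IH]; first exact: framed_mirror1.
by rewrite !expgS framed_mirrorM IH framed_mirror_ft.
Qed.

(** On braids this automorphism undoes the mirror image. It is what lets the
mirror image be moved from the braid to the algebra. *)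
Lemma framed_mirror_braid (a : braid n) :
  framed_mirror (braid_framed d (mirror a)) = braid_framed d a.
Proof.
elim/pres_ind: a => [|i a IH|i a IH].
- by rewrite /mirror /braid_framed (plift1 (@mirror_rel n))
    (plift1 (@fsigma_rel d n)) framed_mirror1.
- rewrite mirrorM !braid_framedM framed_mirrorM IH mirror_sigma.
  rewrite /braid_framed (pliftV (@fsigma_rel d n)) framed_mirrorV.
  rewrite -!/(braid_framed _ _) !braid_framed_sigma framed_mirror_fsigma.
  by rewrite invgK.
- rewrite mirrorM !braid_framedM framed_mirrorM IH mirrorV mirror_sigma invgK.
  rewrite /braid_framed (pliftV (@fsigma_rel d n)) -!/(braid_framed _ _).
  by rewrite !braid_framed_sigma framed_mirror_fsigma.
Qed.

End FramedGroup.

Lemma framed0 d (g : framed d 0) : g = 1%g.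
Proof.
elim/framed_ind: g => [//|a b -> ->|a ->|i|j]; rewrite ?mulg1 ?invg1 //.
  by case: i.
by case: j.
Qed.

(** * Adding a strand *)

Section LastStrand.
Variables d n : nat.

Lemma strand_hi_ord_max :
  strand_hi (ord_max : 'I_n.+2.-1) = ord_max.
Proof. exact: val_inj. Qed.

Lemma strand_lo_ord_max :
  strand_lo (ord_max : 'I_n.+2.-1) = widen_ord (leqnSn n.+1) ord_max.
Proof. exact: val_inj. Qed.

Lemma framed_mirror_add_strand (g : framed d n) :
  framed_mirror (add_strand g) = add_strand (framed_mirror g).
Proof.
elim/framed_ind: g => [|a b IHa IHb|a IH|i|j].
- by rewrite framed_mirror1 !add_strand1 framed_mirror1.
- by rewrite framed_mirrorM !add_strandM framed_mirrorM IHa IHb.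
- by rewrite framed_mirrorV !add_strandV framed_mirrorV IH.
- by rewrite framed_mirror_fsigma add_strandV add_strand_fsigma
    framed_mirror_fsigma.
- by rewrite framed_mirror_ft add_strand_ft framed_mirror_ft.
Qed.

Lemma commute_ft_add_strand (g : framed d n) :
  commute (ft d (ord_max : 'I_n.+1)) (add_strand g).
Proof.
elim/framed_ind: g => [|a b IHa IHb|a IH|i|j].
- by rewrite add_strand1; apply: commute1.
- by rewrite add_strandM; apply: commuteM.
- by rewrite add_strandV; apply: commuteV.
- rewrite add_strand_fsigma /commute ft_fsigma -strand_lo_widen.
  rewrite -strand_hi_widen tpermD // -val_eqE /=; apply/eqP => E.
    by have := ltn_ord (strand_lo i); rewrite /= E ltnn.
  by have := ltn_ord (strand_hi i); rewrite /= E ltnn.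
- by rewrite add_strand_ft; apply: ft_comm.
Qed.

Lemma commute_fsigma_add_strand2 (g : framed d n) :
  commute (@fsigma d n.+2 ord_max) (add_strand (add_strand g)).
Proof.
elim/framed_ind: g => [|a b IHa IHb|a IH|i|j].
- by rewrite !add_strand1; apply: commute1.
- by rewrite !add_strandM; apply: commuteM.
- by rewrite !add_strandV; apply: commuteV.
- rewrite !add_strand_fsigma /commute.
  have lt_i : (i.+1 < n)%N by apply: (ltn_ord (strand_hi i)).
  have := pgen_rel (@FFar d n.+2 (widen_ord (leq_pred n.+1)
    (widen_ord (leq_pred n) i)) ord_max lt_i).
  by rewrite /= !mulg1 => ->.
- rewrite !add_strand_ft /commute ft_fsigma tpermD //.
    by rewrite -val_eqE /= eq_sym neq_ltn ltn_ord.
  by rewrite -val_eqE /= eq_sym neq_ltn ltnS ltnW.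
Qed.

End LastStrand.

(** The induction principle behind the spanning theorem. Inverses of framings
need no case of their own, since framings have finite order; the inverse of the
last crossing does. The condition i.+1 = n, instead of the index [ord_max],
allows n = 0, where there is no crossing. *)
Lemma framed_add_strand_ind d n (d_gt0 : (0 < d)%N)
    (P : framed d n.+1 -> Prop) :
    (forall g : framed d n, P (add_strand g)) ->
    (forall a b, P a -> P b -> P (a * b)%g) ->
    P (ft d ord_max) ->
    (forall i : 'I_n.+1.-1, i.+1 = n ->
       P (fsigma d i) /\ P (fsigma d i)^-1%g) ->
  forall a, P a.
Proof.
move=> Padd PM Pt Ps.
have P1 : P 1%g by rewrite -(add_strand1 d n).
have {}Pt j : P (ft d j).
  have [lt_j|] := ltnP j n.
    have -> : j = widen_ord (leqnSn n) (Ordinal lt_j) by apply: val_inj.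
    by rewrite -add_strand_ft.
  move=> le_j; suff -> : j = ord_max by [].
  by apply/val_inj/anti_leq; rewrite /= -ltnS ltn_ord.
have {}Ps i : P (fsigma d i) /\ P (fsigma d i)^-1%g.
  have [lt_i|] := ltnP i n.-1.
    have -> : i = widen_ord (leq_pred n) (Ordinal lt_i) by apply: val_inj.
    by rewrite -add_strand_fsigma -add_strandV.
  move=> le_i; apply/Ps/anti_leq/andP; split; first exact: (ltn_ord i).
  exact: leq_trans (leqSpred n) _.
apply: pres_ind => [|[i|j] a Pa|[i|j] a Pa]; first exact: P1.
- exact: PM (Ps i).1 Pa.
- exact: PM (Pt j) Pa.
- exact: PM (Ps i).2 Pa.
apply: (PM _ _ _ Pa); rewrite -[(pgen _ _)^-1%g]/(ft d j ^- 1)%g ft_expNn //.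
by elim: (_ * 1)%N => // k Pk; rewrite expgS; apply: PM.
Qed.

Lemma fsigma_braid_last d n :
  let s := @fsigma d n.+3 ord_max in
  let s' := add_strand (@fsigma d n.+2 ord_max) in
  (s * s' * s = s' * s * s')%g.
Proof.
rewrite /= add_strand_fsigma.
have := pgen_rel
  (@FNear d n.+3 (widen_ord (leq_pred n.+2) ord_max) ord_max erefl).
by rewrite /= !mulg1 -!mulgA => ->.
Qed.

(** * The Yokonuma-Hecke algebras and the mirror homomorphism *)

Section YokonumaHeckeAlgebra.
Variables (R : realType) (d : nat).
Local Notation C := (R[i]).

Section FixedStrands.
Variables (n : nat) (q : C).
Implicit Types (a b : Y d n q) (g : framed d n).

Lemma Y_scaleAl (c : C) a b : (c *: a) * b = c *: (a * b).
Proof. by rewrite qscalerAl. Qed.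

Lemma Y_scaleAr (c : C) a b : a * (c *: b) = c *: (a * b).
Proof. by rewrite qscalerAr. Qed.

Lemma Y_ind (P : Y d n q -> Prop) :
    P 0 -> (forall a b, P a -> P b -> P (a + b)) ->
    (forall (c : C) g, P (c *: Yof q g)) ->
  forall a, P a.
Proof.
move=> P0 PD PZ a; rewrite -[a]qreprK [repr a]galgE linear_sum /=.
elim/big_ind: _ => // g _; rewrite -qpiZ; exact: PZ.
Qed.

Definition Ye (i : 'I_n.-1) : Y d n q := qpi (yh_rel q) (e_idem R d i).

Lemma YeE i : Ye i = d%:R^-1 *: \sum_(1 <= s < d.+1)
  Yof q (ft d (strand_lo i) ^+ s * ft d (strand_hi i) ^- s)%g.
Proof. by rewrite /Ye /e_idem -qpiZ linear_sum. Qed.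

Lemma Y_quadratic i :
  Yof q (fsigma d i) * Yof q (fsigma d i) =
  1 + (q - q^-1) *: (Ye i * Yof q (fsigma d i)).
Proof.
apply/eqP; rewrite -subr_eq0 opprD addrA; apply/eqP.
rewrite /Yof /Ye -!qpiM qpiZ -[1 in LHS]qpi1 -!qpiB -expr2.
by apply: qpi_rel; exists i.
Qed.

(** The quadratic relation says (g - (q - q^-1) e) g = 1. *)
Lemma Y_fsigmaV i :
  Yof q (fsigma d i)^-1%g = Yof q (fsigma d i) - (q - q^-1) *: Ye i.
Proof.
have sq : Yof q (fsigma d i) * Yof q (fsigma d i)
    - (q - q^-1) *: (Ye i * Yof q (fsigma d i)) = 1 :> Y d n q.
  by rewrite Y_quadratic addrK.
rewrite -[LHS]mul1r -sq.
by rewrite mulrBl Y_scaleAl -!mulrA -!YofM mulgV mulg1 Yof1 mulr1.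
Qed.

End FixedStrands.

Section Mirror.
Variables (n : nat) (q : C).

(** The inverses g^-1 in Y(q^-1) obey the quadratic relation of Y(q): multiply
g^-1 = g + (q - q^-1) e on the right by g^-1. *)
Lemma Y_fsigmaV_quadratic (i : 'I_n.-1) :
  Yof q^-1 (fsigma d i)^-1%g * Yof q^-1 (fsigma d i)^-1%g =
  1 + (q - q^-1) *: (Ye q^-1 i * Yof q^-1 (fsigma d i)^-1%g).
Proof.
rewrite {1}Y_fsigmaV mulrBl -YofM mulgV Yof1 invrK Y_scaleAl.
by rewrite -scaleNr opprB.
Qed.

Definition galg_mirror : galg C (framed d n) -> Y d n q^-1 :=
  galg_lift (fun g => Yof q^-1 (framed_mirror g)).

HB.instance Definition _ := GRing.Linear.on galg_mirror.

Lemma galg_mirrorM : {morph galg_mirror : a b / a * b}.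
Proof.
apply: (@galg_liftM C (framed d n) (Y d n q^-1) _ (fun u v => u * v))
  => [v c u w|v c u w|g h].
- by rewrite mulrDr Y_scaleAr.
- by rewrite mulrDl Y_scaleAl.
by rewrite framed_mirrorM YofM.
Qed.

Lemma galg_mirror_gbas g :
  galg_mirror (gbas C g) = Yof q^-1 (framed_mirror g).
Proof. exact: galg_lift_gbas. Qed.

Lemma framed_mirror_tt (i j : 'I_n) s :
  framed_mirror (ft d i ^+ s * ft d j ^- s)%g = (ft d i ^+ s * ft d j ^- s)%g.
Proof. by rewrite framed_mirrorM framed_mirrorV !framed_mirror_ftX. Qed.

Lemma galg_mirror_rel a : yh_rel q a -> galg_mirror a = 0.
Proof.
case=> i ->; rewrite !linearB linearZ /= expr2 -gbas1 !galg_mirrorM.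
rewrite !galg_mirror_gbas framed_mirror_fsigma framed_mirror1.
have -> : galg_mirror (e_idem R d i) = Ye q^-1 i.
  rewrite YeE /e_idem linearZ linear_sum /=; congr (_ *: _).
  by apply: eq_bigr => s _; rewrite galg_mirror_gbas framed_mirror_tt.
have cancel2 (V : zmodType) (x y : V) : x + y - x - y = 0.
  by rewrite [x + y]addrC addrK subrr.
by rewrite Y_fsigmaV_quadratic Yof1; apply: cancel2.
Qed.

Definition Ymirror : Y d n q -> Y d n q^-1 := qlift galg_mirror.

Lemma Ymirror_qpi a : Ymirror (qpi (yh_rel q) a) = galg_mirror a.
Proof.
apply: qlift_qpi => b u c /galg_mirror_rel u0.
by rewrite /= !galg_mirrorM u0 mulr0 mul0r.
Qed.

Lemma Ymirror_Yof g : Ymirror (Yof q g) = Yof q^-1 (framed_mirror g).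
Proof. by rewrite Ymirror_qpi galg_mirror_gbas. Qed.

Lemma YmirrorM a b : Ymirror (a * b) = Ymirror a * Ymirror b.
Proof.
rewrite -[a]qreprK -[b]qreprK -[X in Ymirror X]qpiM !Ymirror_qpi.
exact: galg_mirrorM.
Qed.

Lemma Ymirror1 : Ymirror 1 = 1.
Proof.
by have := Ymirror_Yof (1%g : framed d n); rewrite framed_mirror1 !Yof1 => ->.
Qed.

Fact Ymirror_linear : linear Ymirror.
Proof.
move=> c a b; rewrite -[a]qreprK -[b]qreprK.
have lin := Ymirror_qpi (c *: repr a + repr b).
rewrite qpi_is_linear in lin.
rewrite [LHS]lin.
rewrite (Ymirror_qpi (repr a)) (Ymirror_qpi (repr b)).
exact: linearP.
Qed.

HB.instance Definition _ :=
  GRing.isLinear.Build C (Y d n q) (Y d n q^-1) *:%R Ymirror Ymirror_linear.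

Lemma Ymirror0 : Ymirror 0 = 0.
Proof. exact: linear0. Qed.

Lemma YmirrorD a b : Ymirror (a + b) = Ymirror a + Ymirror b.
Proof. exact: linearD. Qed.

Lemma YmirrorZ (c : C) a : Ymirror (c *: a) = c *: Ymirror a.
Proof. exact: linearZ. Qed.

Lemma Yincl0 : Yincl 0 = 0 :> Y d n.+1 q.
Proof. exact: linear0. Qed.

Lemma Yincl_mul (a b : Y d n q) : Yincl (a * b) = Yincl a * Yincl b.
Proof. exact: YinclM. Qed.

Lemma YinclD (a b : Y d n q) : Yincl (a + b) = Yincl a + Yincl b.
Proof. exact: linearD. Qed.

Lemma YinclZ (c : C) (a : Y d n q) : Yincl (c *: a) = c *: Yincl a.
Proof. exact: linearZ. Qed.

End Mirror.

Lemma Ymirror_Yincl n (q : C) (a : Y d n q) :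
  Ymirror (Yincl a) = Yincl (Ymirror a).
Proof.
elim/Y_ind: a => [|a b IHa IHb|c g].
- by rewrite Yincl0 !Ymirror0 Yincl0.
- by rewrite YinclD !YmirrorD IHa IHb YinclD.
by rewrite YinclZ !YmirrorZ YinclZ !(Yincl_Yof, Ymirror_Yof)
  framed_mirror_add_strand.
Qed.

Lemma Yincl_commute_ft n (q : C) (a : Y d n q) k :
  Yof q (ft d ord_max ^+ k)%g * Yincl a = Yincl a * Yof q (ft d ord_max ^+ k)%g.
Proof.
elim/Y_ind: a => [|a b IHa IHb|c g].
- by rewrite Yincl0 mulr0 mul0r.
- by rewrite YinclD mulrDl mulrDr IHa IHb.
rewrite YinclZ Yincl_Yof Y_scaleAl Y_scaleAr -!YofM; congr (_ *: Yof q _).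
exact/commute_sym/commuteX/commute_sym/commute_ft_add_strand.
Qed.

Lemma Yincl2_commute_fsigma n (q : C) (a : Y d n q) :
  Yof q (@fsigma d n.+2 ord_max) * Yincl (Yincl a) =
  Yincl (Yincl a) * Yof q (@fsigma d n.+2 ord_max).
Proof.
elim/Y_ind: a => [|a b IHa IHb|c g].
- by rewrite !Yincl0 mulr0 mul0r.
- by rewrite !YinclD mulrDl mulrDr IHa IHb.
rewrite !YinclZ !Yincl_Yof Y_scaleAl Y_scaleAr -!YofM.
congr (_ *: Yof q _); exact: commute_fsigma_add_strand2.
Qed.

Lemma add_strand_ft_last n k :
  add_strand (ft d (ord_max : 'I_n.+1) ^+ k)%g =
  (ft d (strand_lo (ord_max : 'I_n.+2.-1)) ^+ k)%g.
Proof. by rewrite add_strandX add_strand_ft strand_lo_ord_max. Qed.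

Lemma Y_ft_fsigma_last n (q : C) k :
  Yof q (ft d ord_max ^+ k)%g * Yof q (@fsigma d n.+2 ord_max) =
  Yof q (@fsigma d n.+2 ord_max) * Yincl (Yof q (ft d ord_max ^+ k)%g).
Proof.
rewrite Yincl_Yof -!YofM add_strand_ft_last -ft_hiX_fsigma.
by rewrite strand_hi_ord_max.
Qed.

Lemma Y_fsigma_ft_last n (q : C) k :
  Yof q (@fsigma d n.+2 ord_max) * Yof q (ft d ord_max ^+ k)%g =
  Yincl (Yof q (ft d ord_max ^+ k)%g) * Yof q (@fsigma d n.+2 ord_max).
Proof.
rewrite Yincl_Yof -!YofM add_strand_ft_last ft_loX_fsigma.
by rewrite strand_hi_ord_max.
Qed.

(** The negative powers of t_{n+1} are written as nonnegative ones, which is the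
form in which the Markov rule for framings applies. *)
Lemma Ye_last (d_gt0 : (0 < d)%N) n (q : C) :
  Ye q (ord_max : 'I_n.+2.-1) = d%:R^-1 *: \sum_(1 <= s < d.+1)
    Yincl (Yof q (ft d ord_max ^+ s)%g) *
    Yof q (ft d ord_max ^+ (d.-1 * s))%g.
Proof.
rewrite YeE; congr (_ *: _); apply: eq_bigr => s _.
by rewrite Yincl_Yof -YofM add_strand_ft_last strand_hi_ord_max ft_expNn.
Qed.

Lemma Y_braid_last n (q : C) :
  let s := Yof q (@fsigma d n.+3 ord_max) in
  let s' := Yincl (Yof q (@fsigma d n.+2 ord_max)) in
  s * s' * s = s' * s * s'.
Proof. by move=> s s'; rewrite /s /s' Yincl_Yof -!YofM fsigma_braid_last. Qed.

End YokonumaHeckeAlgebra.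

(** * The spanning theorem *)

Section MarkovSpan.
Variables (R : realType) (d : nat) (d_gt0 : (0 < d)%N) (q : R[i]).
Local Notation C := (R[i]).

(** The crossing is given by i with i.+1 = n rather than by [ord_max], because
for n = 0 there is no crossing. *)
Inductive markov_span n : Y d n.+1 q -> Prop :=
| MSpan0 : markov_span 0
| MSpanD u v : markov_span u -> markov_span v -> markov_span (u + v)
| MSpanT (a : Y d n q) k : markov_span (Yincl a * Yof q (ft d ord_max ^+ k)%g)
| MSpanS (i : 'I_n.+1.-1) (a c : Y d n q) : i.+1 = n ->
    markov_span (Yincl a * Yof q (fsigma d i) * Yincl c).

Lemma markov_spanMl n (b : Y d n q) (u : Y d n.+1 q) :
  markov_span u -> markov_span (Yincl b * u).
Proof.
elim=> {u} [|u v _ IHu _ IHv|a k|i a c i_n].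
- by rewrite mulr0; apply: MSpan0.
- by rewrite mulrDr; apply: MSpanD.
- by rewrite mulrA -Yincl_mul; apply: MSpanT.
- by rewrite !mulrA -Yincl_mul; apply: MSpanS.
Qed.

Lemma markov_spanMr n (u : Y d n.+1 q) (b : Y d n q) :
  markov_span u -> markov_span (u * Yincl b).
Proof.
elim=> {u} [|u v _ IHu _ IHv|a k|i a c i_n].
- by rewrite mul0r; apply: MSpan0.
- by rewrite mulrDl; apply: MSpanD.
- by rewrite -mulrA Yincl_commute_ft mulrA -Yincl_mul; apply: MSpanT.
- by rewrite -!mulrA -Yincl_mul mulrA; apply: MSpanS.
Qed.

Lemma markov_spanZ n (x : C) (u : Y d n.+1 q) :
  markov_span u -> markov_span (x *: u).
Proof.
move=> span_u; rewrite -[u]mul1r -Y_scaleAl -(Yincl1 d n q) -YinclZ.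
exact: markov_spanMl.
Qed.

Lemma markov_span_sum n (I : Type) (r : seq I) (F : I -> Y d n.+1 q) :
  (forall i, markov_span (F i)) -> markov_span (\sum_(i <- r) F i).
Proof.
move=> span_F; elim/big_ind: _ => //; [exact: MSpan0|exact: MSpanD].
Qed.

Lemma markov_span_tMl n k (u : Y d n.+1 q) :
  markov_span u -> markov_span (Yof q (ft d ord_max ^+ k)%g * u).
Proof.
elim=> {u} [|u v _ IHu _ IHv|a l|i a c i_n].
- by rewrite mulr0; apply: MSpan0.
- by rewrite mulrDr; apply: MSpanD.
- rewrite mulrA Yincl_commute_ft -mulrA -YofM -expgnDr; exact: MSpanT.
case: n a c i i_n => [|n] a c i i_n; first by case: i i_n.
have -> : i = ord_max by apply: val_inj; case: i_n.
rewrite !mulrA Yincl_commute_ft -[_ * _ * Yof q (fsigma _ _)]mulrA.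
rewrite Y_ft_fsigma_last !mulrA -[_ * Yincl _ * Yincl _]mulrA -Yincl_mul.
exact: MSpanS.
Qed.

Lemma markov_span_e n (u : Y d n.+2 q) :
  markov_span u -> markov_span (Ye d q (ord_max : 'I_n.+2.-1) * u).
Proof.
move=> span_u; rewrite Ye_last // Y_scaleAl; apply: markov_spanZ.
rewrite mulr_suml; apply: markov_span_sum => s; rewrite -mulrA.
exact/markov_spanMl/markov_span_tMl.
Qed.

Lemma markov_span_fsigma n :
  markov_span (Yof q (@fsigma d n.+2 ord_max)).
Proof.
have := @MSpanS n.+1 ord_max 1 1 erefl.
by rewrite !Yincl1 mul1r mulr1.
Qed.

Lemma markov_span_ft n k : markov_span (Yof q (@ft d n.+1 ord_max ^+ k)%g).
Proof. by have := @MSpanT n 1 k; rewrite Yincl1 mul1r. Qed.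

(** At most one of the two factors g_n remains: for a, c in Y_{n-1},
  g_n (a t_n^k) g_n = a t_{n+1}^k g_n^2, then the quadratic relation applies;
  g_n (a g_{n-1} c) g_n = a g_{n-1} g_n g_{n-1} c by the braid relation. *)
Lemma markov_span_sandwich n (a : Y d n.+1 q) : markov_span a ->
  let s := Yof q (@fsigma d n.+2 ord_max) in
  markov_span (s * Yincl a * s).
Proof.
move=> span_a s; elim: span_a => {a} [|u v _ IHu _ IHv|a k|i a c i_n].
- by rewrite Yincl0 mulr0 mul0r; apply: MSpan0.
- by rewrite YinclD mulrDr mulrDl; apply: MSpanD.
- rewrite Yincl_mul mulrA Yincl2_commute_fsigma -/s -!mulrA.
  rewrite [s * _]mulrA -Y_ft_fsigma_last -/s -mulrA.
  apply: markov_spanMl; apply: markov_span_tMl.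
  rewrite Y_quadratic; apply: MSpanD.
    by have := markov_span_ft n.+1 0; rewrite Yof1.
  apply: markov_spanZ; apply: markov_span_e; exact: markov_span_fsigma.
case: n a c i i_n @s => [|n] a c i i_n s; first by case: i i_n.
have -> : i = ord_max by apply: val_inj; case: i_n.
rewrite !Yincl_mul !mulrA Yincl2_commute_fsigma -/s.
rewrite -!mulrA -[Yincl (Yincl c) * s]Yincl2_commute_fsigma -/s !mulrA.
apply: markov_spanMr; rewrite -!mulrA; apply: markov_spanMl.
rewrite [s * _]mulrA Y_braid_last -/s.
apply: markov_spanMr; apply: markov_spanMl; exact: markov_span_fsigma.
Qed.

Lemma markov_span_fsigmaMl n (u : Y d n.+2 q) :
    (forall a : Y d n.+1 q, markov_span a) ->
  markov_span u -> markov_span (Yof q (@fsigma d n.+2 ord_max) * u).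
Proof.
move=> span_n; elim=> {u} [|u v _ IHu _ IHv|a k|i a c i_n].
- by rewrite mulr0; apply: MSpan0.
- by rewrite mulrDr; apply: MSpanD.
- rewrite -Yincl_commute_ft mulrA Y_fsigma_ft_last -mulrA.
  apply: markov_spanMl; apply: markov_spanMr; exact: markov_span_fsigma.
have -> : i = ord_max by apply: val_inj; case: i_n.
rewrite !mulrA; apply: markov_spanMr; exact: markov_span_sandwich.
Qed.

(** The hypothesis on m is the spanning theorem for one strand less; it is void
for n = 0. *)
Lemma markov_span_stable n (g : framed d n.+1) (u : Y d n.+1 q) :
    (forall m, m.+1 = n -> forall a : Y d m.+1 q, markov_span a) ->
  markov_span u -> markov_span (Yof q g * u).
Proof.
move=> span_n; move: g u; apply: framed_add_strand_ind => //.
- by move=> g u span_u; rewrite -Yincl_Yof; apply: markov_spanMl.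
- by move=> a b IHa IHb u span_u; rewrite YofM -mulrA; apply/IHa/IHb.
- by move=> u span_u; apply: (markov_span_tMl 1).
case: n span_n => [|n] span_n i i_n; first by case: i i_n.
have {i i_n} -> : i = ord_max by apply: val_inj; case: i_n.
have span_s u : markov_span u ->
    markov_span (Yof q (@fsigma d n.+2 ord_max) * u).
  exact/markov_span_fsigmaMl/span_n.
split=> u span_u; first exact: span_s.
rewrite Y_fsigmaV mulrBl -scaleN1r; apply: MSpanD; first exact: span_s.
by apply: markov_spanZ; rewrite Y_scaleAl; apply/markov_spanZ/markov_span_e.
Qed.

(** The span contains 1 and is stable under left multiplication by the images
of all group elements, by induction on the number of strands. *)
Lemma markov_spanP n (u : Y d n.+1 q) : markov_span u.
Proof.
(* Counting strands from m.+1 makes the induction hypothesis the claim for one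
   strand less, which is void at the start. *)
suff {u} span_n m : m.+1 = n.+1 -> forall u : Y d m.+1 q, markov_span u.
  exact: span_n.
elim: {n}n.+1 m => // n IHn m [->] u; elim/Y_ind: u => [|u v|x g].
- exact: MSpan0.
- exact: MSpanD.
apply: markov_spanZ; rewrite -[Yof q g]mulr1 -(Yof1 _ _ q).
apply: markov_span_stable; [exact: IHn|exact: (markov_span_ft n 0)].
Qed.

End MarkovSpan.

(** * Markov traces: uniqueness, E-factorization and pullback *)

Section MarkovTraces.
Variables (R : realType) (d : nat) (d_gt0 : (0 < d)%N).
Local Notation C := (R[i]).

(** The framing rule is required for all k, so x should be d-periodic with
x 0 = 1. The rule for k = 0 then expresses compatibility with the inclusions.
The crossing parameter z is any polynomial, since pulling back along the mirror
homomorphism changes it. *)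
Record markov_trace (q : C) (z : {poly C}) (x : nat -> C)
    (tr : forall n, Y d n q -> {poly C}) : Prop := MarkovTrace {
  mtr_add n (a b : Y d n q) : tr n (a + b) = tr n a + tr n b;
  mtr_scale n (c : C) (a : Y d n q) : tr n (c *: a) = c *: tr n a;
  mtr_comm n (a b : Y d n q) : tr n (a * b) = tr n (b * a);
  mtr_1 n : tr n 1 = 1;
  mtr_sigma n (a : Y d n.+1 q) :
    tr n.+2 (Yincl a * Yof q (@fsigma d n.+2 ord_max)) = z * tr n.+1 a;
  mtr_t n (a : Y d n q) k :
    tr n.+1 (Yincl a * Yof q (@ft d n.+1 ord_max ^+ k)%g) = x k *: tr n a
}.

Section Theory.
Variables (q : C) (z : {poly C}) (x : nat -> C).
Variable tr : forall n, Y d n q -> {poly C}.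
Hypothesis tr_markov : markov_trace z x tr.

Lemma mtr_0 n : tr (0 : Y d n q) = 0.
Proof.
by have := mtr_scale tr_markov (0 : C) (0 : Y d n q); rewrite !scale0r.
Qed.

Lemma mtr_sum n (I : Type) (r : seq I) (F : I -> Y d n q) :
  tr (\sum_(i <- r) F i) = \sum_(i <- r) tr (F i).
Proof.
elim: r => [|i r IH]; first by rewrite !big_nil mtr_0.
by rewrite !big_cons (mtr_add tr_markov) IH.
Qed.

Lemma mtr_crossing n (a c : Y d n.+1 q) :
  tr (Yincl a * Yof q (@fsigma d n.+2 ord_max) * Yincl c) = z * tr (c * a).
Proof.
by rewrite (mtr_comm tr_markov) mulrA -Yincl_mul (mtr_sigma tr_markov).
Qed.

End Theory.

(** The spanning theorem computes the value at an element of Y_{n+1} from values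
on Y_n, and Y_0 consists of scalars. *)
Lemma markov_trace_unique (q : C) (z : {poly C}) (x : nat -> C)
    (f g : forall n, Y d n q -> {poly C}) :
  markov_trace z x f -> markov_trace z x g ->
  forall n (a : Y d n q), f n a = g n a.
Proof.
move=> mf mg; elim=> [|n IHn] a.
  elim/Y_ind: a => [|a b IHa IHb|c h].
  - by rewrite (mtr_0 mf) (mtr_0 mg).
  - by rewrite (mtr_add mf) (mtr_add mg) IHa IHb.
  by rewrite (framed0 h) Yof1 (mtr_scale mf) (mtr_scale mg) (mtr_1 mf)
    (mtr_1 mg).
elim: (markov_spanP d_gt0 a) => {a} [|u v _ IHu _ IHv|a k|i a c i_n].
- by rewrite (mtr_0 mf) (mtr_0 mg).
- by rewrite (mtr_add mf) (mtr_add mg) IHu IHv.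
- by rewrite (mtr_t mf) (mtr_t mg) IHn.
case: n IHn i a c i_n => [|n] IHn i a c i_n; first by case: i i_n.
have -> : i = ord_max by apply: val_inj; case: i_n.
by rewrite (mtr_crossing mf) (mtr_crossing mg) IHn.
Qed.

(** Here x ((d - 1) s) stands for x_{-s}, the indices being taken modulo d. *)
Definition E_system (x : nat -> C) (E : C) := forall k,
  \sum_(1 <= s < d.+1) x (d.-1 * s)%N * x (k + s)%N = d%:R * E * x k.

Section EFactor.
Variables (q : C) (z : {poly C}) (x : nat -> C) (E : C).
Variable tr : forall n, Y d n q -> {poly C}.
Hypothesis tr_markov : markov_trace z x tr.
Hypothesis x_E : E_system x E.

(** This is [mtr_e] once t_{n+1}^{-s} has been traced out. Traced against
t_n^s, the element b g_{n-1} c gives z tr(c b t_{n-1}^s), which is the same sum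
with one strand less; the elements b t_n^k give the E-system. *)
Lemma mtr_sum_t n (a : Y d n.+1 q) :
  \sum_(1 <= s < d.+1)
    x (d.-1 * s)%N *: tr (a * Yof q (ft d ord_max ^+ s)%g) =
  (d%:R * E) *: tr a.
Proof.
(* Counting strands from m.+1 makes the induction hypothesis the claim for one
   strand less, which is void at the start. *)
suff {a} step m : m.+1 = n.+1 -> forall a : Y d m.+1 q,
    \sum_(1 <= s < d.+1)
      x (d.-1 * s)%N *: tr (a * Yof q (ft d ord_max ^+ s)%g) =
    (d%:R * E) *: tr a.
  exact: step.
elim: {n}n.+1 m => // n IHn m [->] a.
elim: (markov_spanP d_gt0 a) => {a} [|u v _ IHu _ IHv|a k|i a c i_n].
- rewrite (mtr_0 tr_markov) scaler0 big1 // => s _.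
  by rewrite mul0r (mtr_0 tr_markov) scaler0.
- rewrite (mtr_add tr_markov) scalerDr -IHu -IHv -big_split /=.
  by apply: eq_bigr => s _; rewrite mulrDl (mtr_add tr_markov) scalerDr.
- rewrite (mtr_t tr_markov) scalerA -x_E scaler_suml; apply: eq_bigr => s _.
  by rewrite -mulrA -YofM -expgnDr (mtr_t tr_markov) scalerA.
case: n IHn i a c i_n => [|n] IHn i a c i_n; first by case: i i_n.
have -> : i = ord_max by apply: val_inj; case: i_n.
rewrite (mtr_crossing tr_markov) scalerAr -(IHn n erefl) [RHS]mulr_sumr.
apply: eq_bigr => s _.
rewrite -mulrA -Yincl_commute_ft mulrA -[_ * _ * Yof q (_ ^+ _)%g]mulrA.
rewrite Y_fsigma_ft_last mulrA -Yincl_mul (mtr_crossing tr_markov).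
by rewrite mulrA scalerAr.
Qed.

(** Tracing out t_{n+1}^{-s} by the framing rule turns e_n into the sum of
[mtr_sum_t]. *)
Lemma mtr_e n (a : Y d n.+1 q) :
  tr (Yincl a * Ye d q (ord_max : 'I_n.+2.-1)) = E *: tr a.
Proof.
have d_neq0 : d%:R != 0 :> C by rewrite pnatr_eq0 -lt0n.
rewrite Ye_last // Y_scaleAr (mtr_scale tr_markov) mulr_sumr.
rewrite (mtr_sum tr_markov).
transitivity (d%:R^-1 *: ((d%:R * E) *: tr a)); last first.
  by rewrite scalerA mulrA mulVf // mul1r.
rewrite -mtr_sum_t; congr (_ *: _); apply: eq_bigr => s _.
by rewrite mulrA -Yincl_mul (mtr_t tr_markov).
Qed.

End EFactor.

(** The parameter changes because g_n is sent to g_n^-1 = g_n + (q - q^-1) e_n,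
and tr(a e_n) = E tr(a). *)
Lemma markov_trace_mirror (q : C) (z : {poly C}) (x : nat -> C) (E : C)
    (tr : forall n, Y d n q^-1 -> {poly C}) :
  markov_trace z x tr -> E_system x E ->
  markov_trace (z + ((q - q^-1) * E)%:P) x
    (fun n (a : Y d n q) => tr n (Ymirror a)).
Proof.
move=> mt x_E; split=> [n a b|n c a|n a b|n|n a|n a k].
- by rewrite YmirrorD (mtr_add mt).
- by rewrite YmirrorZ (mtr_scale mt).
- by rewrite !YmirrorM (mtr_comm mt).
- by rewrite Ymirror1 (mtr_1 mt).
- rewrite YmirrorM Ymirror_Yincl Ymirror_Yof framed_mirror_fsigma Y_fsigmaV.
  rewrite invrK mulrBr Y_scaleAr -scaleNr opprB (mtr_add mt) (mtr_scale mt).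
  by rewrite (mtr_sigma mt) (mtr_e mt x_E) mulrDl scalerA mul_polyC.
- by rewrite YmirrorM Ymirror_Yincl Ymirror_Yof framed_mirror_ftX (mtr_t mt).
Qed.

Lemma markov_trace_comp (q : C) (z p : {poly C}) (x : nat -> C)
    (tr : forall n, Y d n q -> {poly C}) :
  markov_trace z x tr ->
  markov_trace (z \Po p) x (fun n (a : Y d n q) => tr n a \Po p).
Proof.
move=> mt; split=> [n a b|n c a|n a b|n|n a|n a k].
- by rewrite (mtr_add mt) comp_polyD.
- by rewrite (mtr_scale mt) comp_polyZ.
- by rewrite (mtr_comm mt).
- by rewrite (mtr_1 mt) comp_polyC.
- by rewrite (mtr_sigma mt) comp_polyM.
- by rewrite (mtr_t mt) comp_polyZ.
Qed.

End MarkovTraces.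

(** * The parameters attached to D solve the E-system *)

Section RootsOfUnity.
Variables (R : realType) (d : nat) (d_gt0 : (0 < d)%N).
Local Notation C := (R[i]).

Lemma expiD (s t : R) : expi (s + t) = expi s * expi t.
Proof.
rewrite /expi trigo.cosD trigo.sinD; simpc.
by rewrite [X in (_ +i* X)%C]addrC.
Qed.

Lemma expi0 : expi (0 : R) = 1.
Proof. by rewrite /expi trigo.cos0 trigo.sin0. Qed.

Lemma expi_neq1 (t : R) : 0 < t < 2 * trigo.pi -> expi t != 1.
Proof.
case/andP=> t_gt0 t_lt; apply/eqP => -[cos_t _].
(* cos t = 1 would give sin (t / 2) = 0 by the half-angle formula. *)
have tE : t = (t / 2) *+ 2 by rewrite -mulr_natr divfK ?pnatr_eq0.
have sin_gt0 : 0 < trigo.sin (t / 2).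
  by apply: trigo.sin_gt0_pi; rewrite divr_gt0 //= ltr_pdivrMr // mulrC.
have := exprn_gt0 2 sin_gt0; rewrite trigo.sin2cos2.
by rewrite tE trigo.cos_mulr2n in cos_t; lra.
Qed.

Definition zeta : C := expi (2%:R * trigo.pi / d%:R).

Lemma expi_zeta k : expi (2%:R * trigo.pi * k%:R / d%:R) = zeta ^+ k.
Proof.
elim: k => [|k IH]; first by rewrite mulr0 mul0r expi0.
by rewrite exprS -IH -expiD; congr expi; rewrite -[k.+1%:R]nat1r; ring.
Qed.

Lemma zeta_prim : d.-primitive_root zeta.
Proof.
have d_R : 0 < d%:R :> R by rewrite ltr0n.
have zeta_d : zeta ^+ d = 1.
  rewrite -expi_zeta mulfK ?lt0r_neq0 // mulr_natl.
  by rewrite /expi trigo.cos2pi trigo.sin2pi.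
rewrite /primitive_root_of_unity d_gt0; apply/forallP => i; apply/eqP.
rewrite unity_rootE; have [->|i_d] := eqVneq i.+1 d.
  by rewrite zeta_d eqxx.
apply/negbTE; rewrite -expi_zeta; apply: expi_neq1.
have pi_gt0 := trigo.pi_gt0 R.
rewrite divr_gt0 ?mulr_gt0 ?ltr0n //= ltr_pdivrMr // ltr_pM2l ?mulr_gt0 //.
by rewrite ltr_nat ltn_neqAle i_d ltn_ord.
Qed.

Lemma zeta_neq0 : zeta != 0.
Proof.
have := oner_neq0 C; rewrite -(prim_expr_order zeta_prim).
by rewrite expf_eq0 d_gt0.
Qed.

(** A geometric sum: zeta ^ ((d - 1) m) is the inverse of zeta ^ m, so the ratio
is zeta ^ (l - m), which is 1 exactly when m = l. *)
Lemma sum_zeta (m l : 'I_d) :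
  \sum_(1 <= s < d.+1) (zeta ^+ (d.-1 * m) * zeta ^+ l) ^+ s =
  if m == l then d%:R else 0.
Proof.
set u := _ * _; have zeta_d := prim_expr_order zeta_prim.
have u_zeta : u * zeta ^+ m = zeta ^+ l.
  by rewrite mulrAC -exprD addnC -mulSn prednK // exprM zeta_d expr1n mul1r.
have u_d : u ^+ d = 1.
  by rewrite exprMn -!exprM ![(_ * d)%N]mulnC !exprM zeta_d !expr1n mulr1.
rewrite big_add1 /= big_mkord; have [ml|m_l] := eqVneq.
  have u1 : u = 1.
    by apply: (mulIf (expf_neq0 m zeta_neq0)); rewrite u_zeta mul1r ml.
  rewrite u1 (eq_bigr (fun=> 1)) => [|s _]; last exact: expr1n.
  by rewrite sumr_const card_ord.
under eq_bigr do rewrite exprS.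
rewrite -mulr_sumr; apply/eqP; rewrite mulf_eq0; apply/orP; right.
have : (u - 1) * (\sum_(i < d) u ^+ i) = 0 by rewrite -subrX1 u_d subrr.
move/eqP; rewrite mulf_eq0 subr_eq0 => /orP[/eqP u1|//].
case/eqP: m_l; apply/val_inj/eqP; move/eqP: u_zeta; rewrite u1 mul1r.
by rewrite (eq_prim_root_expr zeta_prim) !modn_small.
Qed.

Section Solution.
Variable D : {set 'I_d}.
Hypothesis D_neq0 : D != set0.

Lemma card_D_neq0 : #|D|%:R != 0 :> C.
Proof. by rewrite pnatr_eq0 -lt0n card_gt0. Qed.

Lemma x_solE k : x_sol R D k = #|D|%:R^-1 * \sum_(m in D) zeta ^+ m ^+ k.
Proof.
rewrite /x_sol; congr (_ * _); apply: eq_bigr => m _.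
by rewrite expi_zeta mulnC exprM.
Qed.

Lemma x_sol0 : x_sol R D 0 = 1.
Proof.
rewrite x_solE (eq_bigr (fun=> 1)) => [|m _]; last by rewrite expr0.
by rewrite sumr_const mulVf ?card_D_neq0.
Qed.

Lemma x_sol_mod k : x_sol R D (k %% d) = x_sol R D k.
Proof.
rewrite !x_solE; congr (_ * _); apply: eq_bigr => m _.
by apply: expr_mod; rewrite exprAC (prim_expr_order zeta_prim) expr1n.
Qed.

(** Expanding both factors gives a double sum over m, l in D of zeta ^ (l k)
times a geometric sum, which kills the terms with m != l. *)
Lemma x_sol_E_system : E_system d (x_sol R D) (E_sol R D).
Proof.
move=> k; rewrite /E_sol.
transitivity (#|D|%:R^-1 * #|D|%:R^-1 * \sum_(m in D) \sum_(l in D)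
    zeta ^+ l ^+ k *
    \sum_(1 <= s < d.+1) (zeta ^+ (d.-1 * m) * zeta ^+ l) ^+ s).
  under eq_bigr do rewrite !x_solE mulrACA mulr_suml.
  rewrite -mulr_sumr exchange_big; congr (_ * _); apply: eq_bigr => m _.
  under eq_bigr do rewrite mulr_sumr.
  rewrite exchange_big; apply: eq_bigr => l _.
  rewrite mulr_sumr; apply: eq_bigr => s _.
  by rewrite exprMn [zeta ^+ l ^+ (k + s)]exprD mulrCA -!exprM mulnCA mulnA.
rewrite x_solE -mulrA [d%:R * _]mulrC -mulrA; congr (_ * _).
rewrite mulrCA; congr (_ * _); rewrite mulr_sumr; apply: eq_bigr => m m_D.
rewrite (bigD1 m) //= sum_zeta eqxx big1 ?addr0 1?mulrC // => l /andP[_ l_m].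
by rewrite sum_zeta eq_sym (negbTE l_m) mulr0.
Qed.

End Solution.
End RootsOfUnity.

(** * The specialized trace and its mirror *)

Section Specialization.
Variables (R : realType) (d : nat) (d_gt0 : (0 < d)%N) (D : {set 'I_d}).
Hypothesis D_neq0 : D != set0.
Local Notation C := (R[i]).

Lemma specializeM (p r : trace_ring R d) :
  specialize D (p * r) = specialize D p * specialize D r.
Proof. exact: rmorphM. Qed.

Lemma specializeX i :
  specialize D ('X_i : trace_ring R d) =
  if i == ord0 then 'X else (x_sol R D i)%:P.
Proof. by rewrite /specialize mmapX mmap1U. Qed.

Lemma juyumaya_markov_trace (q : C)
    (tr : forall n, {linear Y d n q -> trace_ring R d}) :
  juyumaya_trace tr ->
  markov_trace 'X (x_sol R D) (fun n (a : Y d n q) => specialize D (tr n a)).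
Proof.
move=> jt; split=> [n a b|n c a|n a b|n|n a|n a k].
- by rewrite linearD /specialize mmapD.
- by rewrite linearZ /= /specialize mmapZ mul_polyC.
- by rewrite (jtr_comm jt).
- by rewrite (jtr_1 jt) /specialize rmorph1.
- by rewrite (jtr_sigma jt) specializeM specializeX eqxx.
(* The framing rule is given for exponents strictly between 0 and d only. *)
have -> : (ft d (ord_max : 'I_n.+1) ^+ k = ft d ord_max ^+ (k %% d))%g.
  by rewrite {1}(divn_eq k d) expgnDr mulnC expgnA ft_expd expg1n mul1g.
rewrite -(x_sol_mod R d_gt0); have := ltn_pmod k d_gt0.
have [-> _|k_gt0 k_lt] := posnP (k %% d)%N.
  by rewrite Yof1 mulr1 (jtr_incl jt) (x_sol0 R D_neq0) scale1r.
rewrite (jtr_t jt) ?k_gt0 // specializeM specializeX.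
have k_val : (inord (k %% d) : 'I_d.-1.+1) = (k %% d)%N :> nat.
  by rewrite inordK // prednK.
by rewrite -val_eqE /= k_val gtn_eqF // mul_polyC.
Qed.

End Specialization.

Theorem proposition3p8 (R : realType) (d n : nat) (d_gt0 : (0 < d)%N)
    (D : {set 'I_d}) (D_neq0 : D != set0)
    (tr : forall (q : R[i]) m, {linear Y d m q -> trace_ring R d})
    (tr_juyumaya : forall q : R[i], q != 0 -> juyumaya_trace (tr q))
    (alpha : braid n) :
  (forall q : R[i], q != 0 ->
     trD D tr q (mirror alpha) =
       trD D tr q^-1 alpha \Po ('X - ((q - q^-1) * E_sol R D)%:P)) /\
  (forall q lam : R[i], q != 0 -> q ^+ 2 != 1 -> lam != 0 -> lam != 1 ->
     trD_lambda D tr q lam (mirror alpha) =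
       trD_lambda D tr q^-1 lam^-1 alpha).
Proof.
have trD_mirror (q : R[i]) : q != 0 -> trD D tr q (mirror alpha) =
    trD D tr q^-1 alpha \Po ('X - ((q - q^-1) * E_sol R D)%:P).
  move=> q_neq0; set c := (q - q^-1) * _.
  have mq := juyumaya_markov_trace d_gt0 D_neq0 (tr_juyumaya _ q_neq0).
  have qV_neq0 : q^-1 != 0 by rewrite invr_eq0.
  have mV := juyumaya_markov_trace d_gt0 D_neq0 (tr_juyumaya _ qV_neq0).
  have := markov_trace_mirror d_gt0 mV (x_sol_E_system R d_gt0 D).
  move/(markov_trace_comp ('X - c%:P)).
  rewrite comp_polyD comp_polyX comp_polyC subrK => mM.
  have := markov_trace_unique d_gt0 mq mM
    (Yof q (braid_framed d (mirror alpha))).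
  by rewrite Ymirror_Yof framed_mirror_braid.
split=> // q lam q_neq0 _ lam_neq0 lam_neq1.
rewrite /trD_lambda trD_mirror // horner_comp; congr _.[_].
rewrite hornerD hornerN hornerX hornerC /z_of_lambda invrK.
have lam1 : 1 - lam != 0 by rewrite subr_eq0 eq_sym.
by field; rewrite subr_eq0 lam_neq0 lam_neq1 q_neq0 lam1.
Qed.
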